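(* Let $\Omega\subset\mathbb{P}(\mathbb{R}^d)$ be a properly convex domain equipped with its Hilbert metric $d_\Omega$, and let $c$ be a geodesic (segment, ray or line) in $(\Omega,d_\Omega)$. Then $c$ is Morse (i.e. $M$-Morse for some Morse gauge $M$) if and only if $c$ is contracting (i.e. $D$-contracting for some $D>0$).
   Context: A properly convex domain $\Omega\subset\mathbb{P}(\mathbb{R}^d)$ is a nonempty open convex set whose closure is a bounded convex subset of some affine chart. The Hilbert metric is $d_\Omega(x,y)=\frac12\log\frac{|a-y||b-x|}{|a-x||b-y|}$, where $a,b\in\partial\Omega$ are the points where the projective line through $x,y$ meets $\partial\Omega$, ordered $a,x,y,b$; $(\Omega,d_\Omega)$ is a proper geodesic metric space. Geodesics are not assumed to be projective segments here. A Morse gauge is any function $M:\mathbb{R}_{\ge0}\times\mathbb{R}_{\ge0}\to\mathbb{R}_{\ge0}$. A geodesic $\ell$ in a proper geodesic metric space is $M$-Morse if every $(\lambda,a)$-quasi-geodesic with endpoints on $\ell$ lies in the $M(\lambda,a)$-neighborhood of $\ell$. For a geodesic $\ell$ in a proper metric space $(X,d)$ let $\pi_\ell(x)=\{y\in\ell: d(x,y)=d(x,\ell)\}$ (set-valued closest-point projection; for $A\subset X$, $\pi_\ell(A)=\bigcup_{x\in A}\pi_\ell(x)$). $\ell$ is $D$-contracting, $D>0$, if for every open metric ball $B_r(x)$ disjoint from $\ell$, $\mathrm{diam}(\pi_\ell(B_r(x)))\le D$. *)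

(* Defs.v *)
From HB Require Import structures.
From mathcomp Require Import all_boot all_order all_algebra.
From mathcomp Require Import all_classical all_reals all_analysis.

Set Implicit Arguments.
Unset Strict Implicit.
Unset Printing Implicit Defensive.

Import Order.TTheory GRing.Theory Num.Theory.
Import numFieldNormedType.Exports.

Local Open Scope classical_set_scope.
Local Open Scope ring_scope.

(** Below, a metric space is a set [X] in a type [T] with a distance
    [dist : T -> T -> R], of which only the values on [X] matter. *)

Section MetricNotions.
Context {R : realType} {T : Type}.
Implicit Types (X l A : set T) (dist : T -> T -> R) (I : set R).

Definition dist_to_set dist (x : T) l : R := inf [set dist x y | y in l].

Definition open_ball X dist (x : T) (r : R) : set T :=
  [set y | X y /\ dist x y < r].

Definition diam dist A : \bar R :=
  ereal_sup [set (dist p.1 p.2)%:E | p in A `*` A].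

Definition isometric_path X dist I (c : R -> T) : Prop :=
  (forall t, I t -> X (c t)) /\
  (forall s t, I s -> I t -> dist (c s) (c t) = `|s - t|).

(** Segments, rays and lines; [b = 0] gives a degenerate segment. *)
Definition geodesic_domain I : Prop :=
  [\/ exists2 b : R, 0 <= b & I = `[0, b]%classic,
      I = `[0, +oo[%classic |
      I = setT].

Definition geodesic X dist l : Prop :=
  exists I (c : R -> T),
    [/\ geodesic_domain I, isometric_path X dist I c & l = c @` I].

(** [q] need not be continuous. *)
Definition quasi_geodesic X dist (lam a s t : R) (q : R -> T) : Prop :=
  (forall u, `[s, t]%classic u -> X (q u)) /\
  (forall u v, `[s, t]%classic u -> `[s, t]%classic v ->
     lam^-1 * `|u - v| - a <= dist (q u) (q v) <= lam * `|u - v| + a).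

Definition morse_gauge (M : R -> R -> R) : Prop :=
  forall lam a, 0 <= lam -> 0 <= a -> 0 <= M lam a.

Definition M_morse X dist (M : R -> R -> R) l : Prop :=
  forall (lam a s t : R) (q : R -> T), 1 <= lam -> 0 <= a -> s <= t ->
    quasi_geodesic X dist lam a s t q -> l (q s) -> l (q t) ->
    forall u, `[s, t]%classic u -> dist_to_set dist (q u) l <= M lam a.

Definition morse X dist l : Prop :=
  exists2 M, morse_gauge M & M_morse X dist M l.

Definition closest_points dist l (x : T) : set T :=
  [set y | l y /\ dist x y = dist_to_set dist x l].

Definition D_contracting X dist (D : R) l : Prop :=
  forall (x : T) (r : R), X x -> 0 < r ->
    open_ball X dist x r `&` l = set0 ->
    (diam dist (\bigcup_(z in open_ball X dist x r) closest_points dist l z)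
       <= D%:E)%E.

Definition contracting X dist l : Prop :=
  exists2 D : R, 0 < D & D_contracting X dist D l.

End MetricNotions.

(** The points of P(R^d) are the lines through 0 in R^d. *)

Definition projective (R : realType) (d : nat) : Type :=
  {L : {vspace 'rV[R]_d} | \dim L == 1%N}.

HB.instance Definition _ (R : realType) (d : nat) :=
  Choice.on (projective R d).

Section ProjectiveTopology.
Variables (R : realType) (d : nat).
Implicit Type U : set (projective R d).

Definition punctured_cone U : set 'rV[R]_d :=
  [set v | v != 0 /\ exists2 p, U p & v \in val p].

(** The quotient topology of R^d \ {0}; as R^d \ {0} is open, openness there
    is openness in R^d. *)
Definition projective_open U : Prop := open (punctured_cone U).

Lemma line_unique (p q : projective R d) (v : 'rV[R]_d) :
  v != 0 -> v \in val p -> v \in val q -> p = q.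
Proof.
move=> v0 vp vq.
have line (r : projective R d) : v \in val r -> <[v]>%VS = val r.
  move=> vr; apply/eqP; rewrite eqEdim; apply/andP; split.
    by rewrite -memvE.
  by rewrite dim_vline v0 (eqP (valP r)).
by apply: val_inj; rewrite -(line p vp) -(line q vq).
Qed.

Lemma projective_openT : projective_open setT.
Proof.
rewrite /projective_open (_ : punctured_cone setT = ~` [set 0]).
  by rewrite openC; apply: accessible_closed_set1; apply: hausdorff_accessible;
    exact: norm_hausdorff.
apply/seteqP; split => v /= => [[v0 _]|/eqP v0]; first exact/eqP.
split=> //.
have dv : \dim <[v]>%VS == 1%N by rewrite dim_vline v0.
by exists (exist _ <[v]>%VS dv) => //=; exact: memv_line.
Qed.

Lemma projective_openI : setI_closed projective_open.
Proof.
move=> U V oU oV; rewrite /projective_open.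
rewrite (_ : punctured_cone (U `&` V) = punctured_cone U `&` punctured_cone V).
  exact: openI.
apply/seteqP; split => v /=.
  by move=> [v0 [p [Up Vp] vp]]; split; split=> //; exists p.
move=> [[v0 [p Up vp]] [_ [q Vq vq]]]; split=> //; exists p => //; split=> //.
by rewrite (line_unique v0 vp vq).
Qed.

Lemma projective_open_bigcup (I : Type) (f : I -> set (projective R d)) :
  (forall i, projective_open (f i)) -> projective_open (\bigcup_i f i).
Proof.
move=> of_; rewrite /projective_open.
rewrite (_ : punctured_cone _ = \bigcup_i punctured_cone (f i)).
  by apply: bigcup_open => i _; exact: of_.
apply/seteqP; split => v /=.
  by move=> [v0 [p [i _ fp] vp]]; exists i => //; split=> //; exists p.
by move=> [i _ [v0 [p fp vp]]]; split=> //; exists p => //; exists i.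
Qed.

HB.instance Definition _ := isOpenTopological.Build (projective R d)
  projective_openT projective_openI projective_open_bigcup.

End ProjectiveTopology.

(** A column [phi] stands for the linear form [v |-> v *m phi]. The chart it
    defines is the complement of the hyperplane [phi = 0], identified with the
    affine hyperplane [phi = 1] of R^d. *)

Section Charts.
Variables (R : realType) (d : nat).
Implicit Types (phi : 'cV[R]_d) (p : projective R d) (S : set (projective R d)).

Definition linear_form phi (v : 'rV[R]_d) : R := (v *m phi) 0 0.

Definition affine_chart phi : set (projective R d) :=
  [set p : projective R d | exists2 v, v \in val p & linear_form phi v != 0].

(** The vector of the line [p] on which [phi] is 1; [vpick] is some nonzero
    vector of the line. *)
Definition chart_coord phi p : 'rV[R]_d :=
  (linear_form phi (vpick (val p)))^-1 *: vpick (val p).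

Definition convex_in_chart phi S : Prop :=
  S `<=` affine_chart phi /\ convex_set (chart_coord phi @` S).

Definition bounded_in_chart phi S : Prop :=
  S `<=` affine_chart phi /\ bounded_set (chart_coord phi @` S).

End Charts.

Section Hilbert.
Variables (R : realType) (d : nat).
Implicit Types (phi : 'cV[R]_d) (Omega : set (projective R d))
  (x y : projective R d).

Definition properly_convex_in phi Omega : Prop :=
  [/\ Omega !=set0, open Omega, convex_in_chart phi Omega,
      convex_in_chart phi (closure Omega) &
      bounded_in_chart phi (closure Omega)].

Definition properly_convex Omega : Prop :=
  exists phi, properly_convex_in phi Omega.

Definition frontier Omega : set (projective R d) :=
  closure Omega `\` interior Omega.

Definition strictly_between (u v w : 'rV[R]_d) : Prop :=
  exists2 t : R, 0 < t < 1 & v = (1 - t) *: u + t *: w.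

(** [r] is the value of the Hilbert distance formula at distinct points [x, y],
    computed in the chart [phi]. The points a, x, y, b lie in this order on a
    line, so the ratios of lengths do not depend on the norm used. *)
Definition hilbert_value phi Omega x y (r : R) : Prop :=
  exists a b : projective R d,
    [/\ frontier Omega a /\ frontier Omega b,
        strictly_between (chart_coord phi a) (chart_coord phi x)
          (chart_coord phi y),
        strictly_between (chart_coord phi x) (chart_coord phi y)
          (chart_coord phi b) &
        let dst p q := `|chart_coord phi p - chart_coord phi q| in
        r = 2^-1 * ln ((dst a y * dst b x) / (dst a x * dst b y))].

(** The cross-ratio is a projective invariant, so the chart chosen among those
    in which [Omega] is properly convex is irrelevant. [xget 0 A] is an element
    of [A] when there is one. *)
Definition hilbert_chart Omega : 'cV[R]_d :=
  xget 0 [set phi | properly_convex_in phi Omega].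

Definition hilbert_dist Omega x y : R :=
  if x == y then 0
  else xget 0 (hilbert_value (hilbert_chart Omega) Omega x y).

End Hilbert.

(* Main.v *)
(* Morse implies contracting. Suppose that [x] and [y] have closest points [p]
   and [q] on [c] at distance [L], although [d(x, y) < d(x, c)]. Truncate the
   segments [px] and [qy] at distance [10 L] from [c]. The path from [p] through
   the truncated points [x'] and [y'] to [q], or to the first point of [c] to
   which [x' y'] comes [r]-close, has length [O(L)] and stays [r]-far from [c]
   except near its ends. Weight the metric by a large factor inside the
   [r]-neighbourhood of [c]: geodesics of the weighted metric are uniform
   quasi-geodesics, so for [r] large they stay in that neighbourhood by the
   Morse property and cost more than the path, which bounds [L].

   Hilbert geometry enters only to exclude that [x' y'] returns to [c] too
   close to [p]. In the cone over [Omega], write the point [w] of [x' y'] as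
   [P + Q + Z] with [P], [Q], [Z] multiples of [p], [q] and of a point [z] of
   [xy]. If [w] is [r]-close to a point [k] of [c] and [p], [q] are closer to
   [k] than [x'], [y'] are, then [P] and [Q] are small multiples of [k], hence
   [Z] is comparable to [k], that is, [z] is [(r + 1)]-close to [c]. As
   [d(x, y) < d(x, c)], this can only happen near [q].

   Contracting implies Morse in every metric space: a quasi-geodesic that is far
   from [c] has a projection to [c] that moves much more slowly than itself. *)

Require Import Defs.
From HB Require Import structures.
From mathcomp Require Import all_boot all_order all_algebra.
From mathcomp Require Import all_classical all_reals all_analysis.
From mathcomp Require Import ring lra zify.

Set Implicit Arguments.
Unset Strict Implicit.
Unset Printing Implicit Defensive.

Import Order.TTheory GRing.Theory Num.Theory.
Import numFieldNormedType.Exports.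

Local Open Scope classical_set_scope.
Local Open Scope ring_scope.

(** * Geodesics and contracting projections *)

Definition metric_on (R : realType) (T : Type) (X : set T)
    (dist : T -> T -> R) : Prop :=
  [/\ forall x, X x -> dist x x = 0,
      forall x y, X x -> X y -> 0 <= dist x y,
      forall x y, X x -> X y -> dist x y = dist y x &
      forall x y z, X x -> X y -> X z -> dist x z <= dist x y + dist y z].

Section Geodesics.
Variables (R : realType) (T : Type) (X : set T) (dist : T -> T -> R).
Hypothesis Xmetric : metric_on X dist.

Let dist0 : forall x, X x -> dist x x = 0. Proof. by case: Xmetric. Qed.
Let dist_ge0 : forall x y, X x -> X y -> 0 <= dist x y.
Proof. by case: Xmetric. Qed.
Let distC : forall x y, X x -> X y -> dist x y = dist y x.
Proof. by case: Xmetric. Qed.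
Let dist_tri : forall x y z, X x -> X y -> X z ->
  dist x z <= dist x y + dist y z.
Proof. by case: Xmetric. Qed.

Lemma geodesic_sub (l : set T) : geodesic X dist l -> l `<=` X.
Proof. by move=> [I [c [_ [Xc _] ->]]] _ [t It <-]; exact: Xc. Qed.

Lemma dist_to_set_le (l : set T) (x y : T) : l `<=` X -> X x -> l y ->
  dist_to_set dist x l <= dist x y.
Proof.
move=> lX Xx ly; apply: ge_inf; last by exists y.
by exists 0 => _ [z lz <-]; apply: dist_ge0 => //; exact: lX.
Qed.

(** Closest points come from the extreme value theorem, which needs a compact interval of
    parameters; rays and lines are cut off at [N]. *)
Lemma geodesic_domain_section (I : set R) (N : R) : 0 <= N ->
  geodesic_domain I -> exists a b : R, [/\ a <= b, `[a, b] `<=` I &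
    forall t, I t -> `|t| <= N -> t \in `[a, b]].
Proof.
move=> N0 [[b b0 ->]|->|->].
- by exists 0, b; split.
- exists 0, N; split => // t /=; rewrite !in_itv /=.
    by move=> /andP[->].
  by rewrite andbT => t0; rewrite ger0_norm// t0.
- exists (- N), N; split => //; first lra.
  by move=> t _; rewrite ler_norml /= in_itv.
Qed.

(* Only parameters within [2 dist x (c 0)] of [0] compete with [c 0], which
   leaves a compact interval. *)
Lemma closest_points_nonempty (l : set T) (x : T) :
  geodesic X dist l -> X x -> closest_points dist l x !=set0.
Proof.
move=> lgeo Xx; have lX := geodesic_sub lgeo.
case: lgeo => I [c [domI [Xc isoc] lE]].
have I0 : I 0.
  by case: domI => [[b b0 ->]|->|->] //=; rewrite in_itv /= lexx.
have N0 : 0 <= 2 * dist x (c 0) by rewrite mulr_ge0// dist_ge0//; exact: Xc.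
have [a [b [ab abI Iab]]] := geodesic_domain_section N0 domI.
have lip s t : I s -> I t -> dist x (c s) <= dist x (c t) + `|t - s|.
  by move=> Is It; rewrite -isoc//; apply: dist_tri => //; exact: Xc.
(* Nothing is known about [c] outside [I]. Composing with the retraction onto [[a, b]] gives a
   function that is continuous on all of [R]. *)
pose clamp t := Num.max a (Num.min t b).
have clampab t : clamp t \in `[a, b].
  by rewrite in_itv /= le_max lexx /= ge_max ab ge_min lexx orbT.
have cont : {within `[a, b], continuous (fun t => dist x (c (clamp t)))}.
  apply: continuous_subspaceT => t; apply/cvgrPdist_lt => e e0.
  near=> u.
  have clip : `|clamp t - clamp u| <= `|t - u|.
    have h1 := ler_norm (t - u); have := ler_norm (u - t); rewrite distrC => h2.
    rewrite ler_norml /clamp.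
    have [?|?] := leP t b; have [?|?] := leP u b; do ?case: (leP a _) => ?; lra.
  have It := abI _ (clampab t); have Iu := abI _ (clampab u).
  have := lip _ _ It Iu; have := lip _ _ Iu It.
  rewrite (distrC (clamp u)) => h1 h2.
  apply: (@le_lt_trans _ _ `|t - u|); first by rewrite ler_norml; lra.
  by near: u; exact: cvgr_dist_lt.
have [t0 t0ab t0min] := EVT_min ab cont.
have clampE t : t \in `[a, b] -> clamp t = t.
  rewrite in_itv /= => /andP[at_ tb]; rewrite /clamp.
  by rewrite (min_idPl tb) (max_idPr at_).
have {}t0min t : t \in `[a, b] -> dist x (c t0) <= dist x (c t).
  by move=> tab; have := t0min t tab; rewrite !clampE.
have It0 := abI _ t0ab.
exists (c t0); split; first by rewrite lE; exists t0.
apply/eqP; rewrite eq_le; apply/andP; split; last first.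
  by apply: dist_to_set_le => //; rewrite lE; exists t0.
apply: lb_le_inf.
  by exists (dist x (c 0)), (c 0) => //; rewrite lE; exists 0.
move=> _ [_ /[!lE] -[t It <-] <-].
have [tN|tN] := leP `|t| (2 * dist x (c 0)).
  by apply: t0min; exact: Iab.
apply: (@le_trans _ _ (dist x (c 0))).
  by apply: t0min; apply: Iab => //; rewrite normr0.
have := dist_tri (Xc _ I0) Xx (Xc _ It).
rewrite isoc// sub0r normrN (distC (Xc _ I0) Xx); lra.
Unshelve. all: by end_near. Qed.

(** * Excursions away from a contracting geodesic *)

Section Contracting.
Variable (l : set T).
Hypothesis lgeo : geodesic X dist l.

Let lX : l `<=` X. Proof. exact: geodesic_sub. Qed.

Lemma dist_to_set_lip (x y : T) : X x -> X y ->
  dist_to_set dist x l <= dist x y + dist_to_set dist y l.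
Proof.
move=> Xx Xy; have [p [lp <-]] := closest_points_nonempty lgeo Xy.
apply: le_trans (dist_to_set_le lX Xx lp) _.
by apply: dist_tri => //; exact: lX.
Qed.

Lemma open_ball_disjoint (x : T) (r : R) : X x ->
  open_ball X dist x r `&` l = set0 <-> r <= dist_to_set dist x l.
Proof.
move=> Xx; split=> [rl|rl].
  have [p [lp <-]] := closest_points_nonempty lgeo Xx.
  rewrite leNgt; apply/negP => pr.
  suff : (set0 : set T) p by [].
  by rewrite -rl; do 2!split => //; exact: lX.
rewrite -subset0 => y [[Xy yr] ly].
by have := dist_to_set_le lX Xx ly; rewrite leNgt (lt_le_trans yr rl).
Qed.

Lemma contracting_closest_points (D r : R) (x y z p q : T) :
  D_contracting X dist D l -> X x -> 0 < r -> r <= dist_to_set dist x l ->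
  open_ball X dist x r y -> open_ball X dist x r z ->
  closest_points dist l y p -> closest_points dist l z q -> dist p q <= D.
Proof.
move=> cD Xx r0 /(open_ball_disjoint _ Xx) rl By Bz yp zq.
have /(le_trans _) := cD x r Xx r0 rl; rewrite -lee_fin; apply.
apply: ereal_sup_ubound; exists (p, q) => //=.
by split => /=; [exists y|exists z].
Qed.

(** If [v i] is far from [l], let [j] and [k] be the last index before and the first index after [i]
    with samples [r]-close to [l]. In between, consecutive samples share a ball of radius [r]
    disjoint from [l], so the projection moves by at most [D] per step and
    [d(v j, v k) <= 2 r + D (k - j)]. The samples progress at rate [2 D] up to [B], hence
    [D (k - j) <= 2 r + B]. *)
Lemma contracting_excursion (D r B : R) (v : nat -> T) (N : nat) :
  D_contracting X dist D l -> 0 < D -> 0 < r ->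
  (forall i, X (v i)) -> l (v 0%N) -> l (v N) ->
  (forall i, dist (v i) (v i.+1) < r) ->
  (forall i j, (i < j <= N)%N ->
     2 * D * (j%:R - i%:R) - B <= dist (v i) (v j)) ->
  forall i, (i <= N)%N -> exists j, [/\ (j <= i)%N,
    dist_to_set dist (v j) l <= r & j = i \/ D * (i%:R - j%:R) <= 2 * r + B].
Proof.
move=> cD D0 r0 Xv lv0 lvN vr vlow i iN.
pose P j := dist_to_set dist (v j) l <= r.
have Pl j : l (v j) -> P j.
  move=> lv; apply: le_trans (dist_to_set_le lX (Xv _) lv) _.
  by rewrite dist0// ltW.
have [Pi|Pi] := boolP (P i); first by exists i; split => //; left.
have exj : exists j, (j <= i)%N && P j by exists 0%N; rewrite leq0n Pl.
have ubj j : (j <= i)%N && P j -> (j <= i)%N by case/andP.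
have exk : exists k, (i <= k)%N && P k by exists N; rewrite iN Pl.
case: (ex_maxnP exj ubj) => j /andP[ji Pj] jmax.
case: (ex_minnP exk) => k /andP[ik Pk] kmin.
exists j; split => //; right.
have kN : (k <= N)%N by apply: kmin; rewrite iN Pl.
have ltji : (j < i)%N.
  by rewrite ltn_neqAle ji andbT; apply: contraNneq Pi => <-.
have ltik : (i < k)%N.
  by rewrite ltn_neqAle ik andbT; apply: contraNneq Pi => ->.
have out m : (j < m < k)%N -> r < dist_to_set dist (v m) l.
  move=> /andP[jm mk]; rewrite ltNge; apply/negP; rewrite -/(P m) => Pm.
  have [mi|im] := leqP m i.
    by have := jmax m; rewrite mi Pm /= => /(_ isT); rewrite leqNgt jm.
  by have := kmin m; rewrite (ltnW im) Pm /= => /(_ isT); rewrite leqNgt mk.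
have /choice [p pP] m := closest_points_nonempty lgeo (Xv m).
have lp m : X (p m) by apply: lX; case: (pP m).
have self m : open_ball X dist (v m) r (v m) by split => //; rewrite dist0.
have step m : (j <= m < k)%N -> dist (p m) (p m.+1) <= D.
  move=> /andP[jm mk].
  (* The sample [v j] may be too close to [l] to be the centre of the ball. The first step uses the
     ball about [v j.+1], and [j.+1 < k] because [j < i < k]. *)
  have [->|mj] := eqVneq m j.
    apply: (contracting_closest_points cD (Xv j.+1) r0 _ _ _ (pP _) (pP _))
      => //.
      by apply/ltW/out; rewrite leqnn (leq_ltn_trans ltji).
    by split => //; rewrite distC.
  have ltjm : (j < m)%N by rewrite ltn_neqAle eq_sym mj.
  apply: (contracting_closest_points cD (Xv m) r0 _ _ _ (pP _) (pP _)) => //.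
  by apply/ltW/out; rewrite ltjm.
have tele m : (j + m <= k)%N -> dist (p j) (p (j + m)%N) <= D * m%:R.
  elim: m => [|m IH] jmk; first by rewrite addn0 dist0// mulr0.
  apply: le_trans (dist_tri (lp _) (lp (j + m)%N) (lp _)) _.
  rewrite -natr1 mulrDr mulr1; apply: lerD; first by apply: IH; lia.
  by rewrite addnS; apply: step; lia.
have := tele (k - j)%N; rewrite subnKC; last lia.
move=> /(_ (leqnn _)); rewrite natrB; last lia.
have [_ pjE] := pP j; have [_ pkE] := pP k.
have := vlow j k; rewrite kN (ltn_trans ltji ltik) => /(_ isT).
have := dist_tri (Xv j) (lp j) (Xv k); have := dist_tri (lp j) (lp k) (Xv k).
rewrite (distC (lp k) (Xv k)) pjE pkE; move: Pj Pk; rewrite /P.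
have : D * (i%:R - j%:R) <= D * (k%:R - j%:R) :> R.
  by rewrite ler_pM2l// lerD2r ler_nat.
lra.
Qed.

(** The quasi-geodesic is sampled with period [tau = 2 lam D], so that its lower bound gives a
    progress of [2 D] per sample. The gauge is [rad] plus the distance that can be covered since the
    last sample close to [l]. *)
Lemma contracting_morse : contracting X dist l -> morse X dist l.
Proof.
move=> [D D0 cD].
(* Consecutive samples are at distance at most [lam tau + a]; the summand 1 makes the comparison
   with the radius strict. *)
pose rad lam a : R := 2 * lam ^+ 2 * D + a + 1.
exists (fun lam a => rad lam a +
    (2 * lam ^+ 2 * (2 * rad lam a + (2 * D + a)) + 2 * lam ^+ 2 * D + a)).
  move=> lam a lam0 a0; rewrite /rad.
  by rewrite !(addr_ge0, mulr_ge0, exprn_ge0) // ltW.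
move=> lam a s t q lam1 a0 st [qX qqi] lqs lqt u0 /=.
rewrite in_itv /= => /andP[su0 u0t].
set r := rad lam a; pose tau := 2 * lam * D.
have lam0 : 0 < lam by lra.
have tau0 : 0 < tau by rewrite !mulr_gt0.
have lamtau : lam * tau = 2 * lam ^+ 2 * D by rewrite /tau; ring.
have lamtau' : lam^-1 * tau = 2 * D by rewrite /tau; field; rewrite gt_eqF.
have lt0 : 0 < lam * tau by rewrite mulr_gt0.
have rE : r = lam * tau + a + 1 by rewrite lamtau.
have r0 : 0 < r by lra.
(* Cutting off at [t] makes the last sample an endpoint, hence a point of [l]. The last period may
   be incomplete, which costs one index in the lower bound and explains the summand [2 D] of [B]. *)
pose w i := Num.min (s + i%:R * tau) t.
have wst i : `[s, t]%classic (w i).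
  by rewrite /= in_itv /= le_min st ge_min lexx orbT andbT lerDl mulr_ge0// ltW.
pose v i := q (w i).
pose N := (Num.truncn ((t - s) / tau)).+1.
have wN : w N = t.
  apply/min_idPr; rewrite -lerBlDl -ler_pdivrMr//.
  by apply/ltW; rewrite /N truncnS_gt.
have w0 : w 0%N = s by rewrite /w mul0r addr0 (min_idPl st).
have iN : (Num.truncn ((u0 - s) / tau) <= N)%N.
  by apply/leqW/le_truncn; rewrite ler_pM2r ?invr_gt0// lerB.
have [] := @contracting_excursion D r (2 * D + a) v N cD D0 r0 _ _ _ _ _ _ iN.
- by move=> i; exact: qX.
- by rewrite /v w0.
- by rewrite /v wN.
- move=> i; have /andP[_] := qqi _ _ (wst i) (wst i.+1).
  have : `|w i - w i.+1| <= tau.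
    rewrite /w -natr1 mulrDl mul1r addrA ler_norml.
    by case: (leP (s + i%:R * tau) t) => ?;
      case: (leP (s + i%:R * tau + tau) t) => ?; lra.
  rewrite -(ler_pM2l lam0) /v; lra.
- move=> i j /andP[ij jN]; have /andP[+ _] := qqi _ _ (wst i) (wst j).
  have : (j%:R - i%:R - 1) * tau <= `|w i - w j|.
    have jt : (j%:R - 1) * tau <= t - s.
      rewrite -ler_pdivlMr// lerBlDr; apply: le_trans (_ : N%:R <= _).
        by rewrite ler_nat.
      by rewrite /N -natr1 lerD2r truncn_le divr_ge0 ?subr_ge0// ltW.
    have wi : w i <= s + i%:R * tau by rewrite ge_min lexx.
    have wj : s + (j%:R - 1) * tau <= w j.
      by rewrite le_min; apply/andP; split; lra.
    by rewrite distrC; apply: le_trans (ler_norm _); lra.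
  rewrite -(@ler_pM2l _ lam^-1) ?invr_gt0// mulrCA lamtau' /v; lra.
move=> j [ji vjr jE].
set i := Num.truncn _ in ji jE iN.
have := truncn_itv (x := (u0 - s) / tau).
rewrite divr_ge0 ?subr_ge0 ?(ltW tau0)// -/i ler_pdivlMr// ltr_pdivrMr//.
move=> /(_ isT) /andP[iu ui].
have jiR : j%:R <= i%:R :> R by rewrite ler_nat.
have wj : w j = s + j%:R * tau.
  apply/min_idPl.
  by have : j%:R * tau <= i%:R * tau by [rewrite ler_pM2r|]; lra.
have Xu0 : X (q u0) by apply: qX; rewrite /= in_itv /= su0.
apply: le_trans (dist_to_set_lip Xu0 (qX _ (wst j))) _.
rewrite addrC lerD//.
have u0st : `[s, t]%classic u0 by rewrite /= in_itv /= su0.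
have /andP[_ /le_trans] := qqi _ _ u0st (wst j); apply; rewrite lerD2r.
have : j%:R * tau <= i%:R * tau by rewrite ler_pM2r.
move: ui; rewrite -natr1 mulrDl mul1r => ui h1.
have : `|u0 - w j| <= (i%:R - j%:R) * tau + tau.
  by rewrite wj ger0_norm; lra.
rewrite -(ler_pM2l lam0) => /le_trans; apply.
rewrite mulrDr lamtau lerD2r mulrCA lamtau.
have -> : (i%:R - j%:R) * (2 * lam ^+ 2 * D) =
  2 * lam ^+ 2 * (D * (i%:R - j%:R)) by ring.
rewrite ler_pM2l ?mulr_gt0 ?exprn_gt0//.
case: jE => // ->; rewrite subrr mulr0; lra.
Qed.

End Contracting.
End Geodesics.

(** * Morse geodesics *)

(** Two points may be joined by several geodesics of a Hilbert metric, so a family of segments is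
    prescribed; it will be that of the projective segments. The third clause allows a segment to be
    traversed piece by piece. *)
Definition geodesic_segments (R : realType) (T : Type) (X : set T)
    (dist : T -> T -> R) (seg : T -> T -> set T) : Prop :=
  [/\ forall a b, X a -> X b -> seg a b a /\ seg a b b,
      forall a b u, X a -> X b -> seg a b u ->
        X u /\ dist a u + dist u b = dist a b,
      forall a b u v, X a -> X b -> seg a b u -> seg u b v -> seg a b v &
      forall a b t, X a -> X b -> 0 <= t <= dist a b ->
        exists2 u, seg a b u & dist a u = t].

(* If [w] is on the segment between points of the sides [p x] and [q y] and
   these points are further from [c] than [p] and [q] are, then a point of the
   opposite side [x y] is not much further from [c] than [w] is. *)
Definition quadrilateral_property (R : realType) (T : Type) (X : set T)
    (dist : T -> T -> R) (seg : T -> T -> set T) : Prop :=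
  forall r p x q y x' y' w c,
    [/\ X p, X x, X q & X y] -> X c ->
    seg p x x' -> seg q y y' -> seg x' y' w -> dist w c <= r ->
    x' = x \/ dist p c + r + 2 <= dist x' c ->
    y' = y \/ dist q c + r + 2 <= dist y' c ->
    exists z, [/\ X z, dist x z + dist z y = dist x y & dist z c <= r + 1].

Section Chains.
Variables (T : Type) (step : T -> T -> Prop).

Definition chain (n : nat) (a b : T) : Prop :=
  exists v : nat -> T, [/\ v 0%N = a, v n = b &
    forall i, (i < n)%N -> step (v i) (v i.+1)].

Lemma chain_cat n m a b c : chain n a b -> chain m b c -> chain (n + m) a c.
Proof.
move=> [f [f0 fn fs]] [g [g0 gm gs]].
exists (fun i => if (i < n)%N then f i else g (i - n)%N); split.
- by case: n fn {fs} => [|n _]; rewrite ?ltnn ?subn0 ?ltn0Sn// f0 => ->.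
- by rewrite ltnNge leq_addr addKn.
- move=> i inm; have [im|im] := ltnP i n.
    have [jm|jm] := ltnP i.+1 n; first exact: fs.
    have -> : i.+1 = n by lia.
    by rewrite subnn g0 -fn; have <- : i.+1 = n by [lia]; apply: fs.
  by rewrite ltnNge (leqW im) /= subSn//; apply: gs; lia.
Qed.

Lemma chain_sub (v : nat -> T) n i j :
  (forall k, (k < n)%N -> step (v k) (v k.+1)) -> (i <= j <= n)%N ->
  chain (j - i) (v i) (v j).
Proof.
move=> vs /andP[ij jn]; exists (fun k => v (i + k)%N); split.
- by rewrite addn0.
- by rewrite subnKC.
- by move=> k kji; rewrite addnS; apply: vs; lia.
Qed.

End Chains.

Section Segments.
Variables (R : realType) (T : Type) (X : set T) (dist : T -> T -> R).
Variable seg : T -> T -> set T.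
Hypotheses (Xmetric : metric_on X dist) (Xseg : geodesic_segments X dist seg).

Let dist0 : forall x, X x -> dist x x = 0. Proof. by case: Xmetric. Qed.
Let dist_ge0 : forall x y, X x -> X y -> 0 <= dist x y.
Proof. by case: Xmetric. Qed.
Let distC : forall x y, X x -> X y -> dist x y = dist y x.
Proof. by case: Xmetric. Qed.
Let dist_tri : forall x y z, X x -> X y -> X z ->
  dist x z <= dist x y + dist y z.
Proof. by case: Xmetric. Qed.

Lemma segment_samples (a b : T) (eta : R) : X a -> X b -> 0 < eta ->
  exists n (v : nat -> T), [/\ n%:R <= dist a b / eta + 1, v 0%N = a, v n = b,
    forall i, seg a b (v i) &
    forall i, (i < n)%N -> dist (v i) (v i.+1) <= eta].
Proof.
have [seg_ends seg_sub seg_trans seg_pt] := Xseg.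
move=> Xa Xb eta0.
have abeta : 0 <= dist a b / eta by rewrite divr_ge0 ?dist_ge0// ltW.
suff H n : forall a, X a -> dist a b <= n.+1%:R * eta -> exists v : nat -> T,
    [/\ v 0%N = a, v n.+1 = b, forall i, seg a b (v i) &
     forall i, (i < n.+1)%N -> dist (v i) (v i.+1) <= eta].
  have [|v [v0 vn vs ve]] := H (Num.truncn (dist a b / eta)) a Xa.
    by rewrite -ler_pdivrMr// ltW// truncnS_gt.
  exists (Num.truncn (dist a b / eta)).+1, v; split => //.
  by rewrite -natr1 lerD2r truncn_le.
elim: n {abeta} => [|n IH] {}a {}Xa; have [sa sb] := seg_ends a b Xa Xb.
  rewrite mul1r => abe; exists (fun i => if i is 0%N then a else b).
  by split => // -[].
move=> ab; have [u sau [ue ub]] : exists2 u, seg a b u &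
    dist a u <= eta /\ dist u b <= n.+1%:R * eta.
  (* The number of steps is fixed in advance; when [b] is already within [eta], the first step stays
     at [a]. *)
  have [abe|/ltW abe] := leP (dist a b) eta.
    exists a => //; rewrite dist0// ltW//; split => //.
    by apply: le_trans abe _; rewrite ler_peMl ?ler1n// ltW.
  have [|u sau aue] := seg_pt a b eta Xa Xb; first by rewrite ltW.
  exists u => //; have [_] := seg_sub _ _ _ Xa Xb sau.
  move: ab; rewrite aue -[n.+2%:R]natr1 mulrDl mul1r; lra.
have [Xu _] := seg_sub _ _ _ Xa Xb sau.
have [v [v0 vn vs ve]] := IH u Xu ub.
exists (fun i => if i is j.+1 then v j else a); split => //.
  by case=> // i; apply: seg_trans sau (vs i).
by case=> [|i] in_; rewrite ?v0//; apply: ve.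
Qed.

(** * Chains in the weighted metric *)

Section MorseGeodesic.
Variable (l : set T).
Hypothesis lgeo : geodesic X dist l.
Variables (K r : R).
Hypotheses (K1 : 1 <= K) (r0 : 0 < r).

Let K0 : 0 < K. Proof. by rewrite (lt_le_trans ltr01). Qed.
Let lX : l `<=` X. Proof. exact: (geodesic_sub lgeo). Qed.

(* Steps at distance at least [r] from [l] are longer by a factor [K]: a chain
   with few steps prefers to travel far from [l]. *)
Definition conformal_step (a b : T) : Prop :=
  [/\ X a, X b & dist a b <= K^-1 \/
    dist a b <= 1 /\ r <= dist_to_set dist a l].

(** Steps of length [K^-1] are allowed everywhere, at a price of [K] steps per unit of length. *)
Lemma chain_segment (a b : T) : X a -> X b -> exists2 n,
  n%:R <= K * dist a b + 1 & chain conformal_step n a b.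
Proof.
have [_ seg_sub _ _] := Xseg.
move=> Xa Xb; have K'0 : 0 < K^-1 by rewrite invr_gt0.
have [n [v [nle v0 vn vs ve]]] := segment_samples Xa Xb K'0.
exists n; first by rewrite mulrC -[X in _ * X]invrK.
exists v; split => // i /ve iK; split; last by left.
  by have [] := seg_sub _ _ _ Xa Xb (vs i).
by have [] := seg_sub _ _ _ Xa Xb (vs i.+1).
Qed.

(** Unit steps are allowed up to the first sample [u] that is [r]-close to [l], at a price of one
    step per unit of length. *)
Lemma chain_far_segment (a b : T) : X a -> X b -> exists n u,
  [/\ n%:R <= dist a b + 1, seg a b u, chain conformal_step n a u &
      u = b \/ dist_to_set dist u l <= r].
Proof.
have [_ seg_sub _ _] := Xseg.
move=> Xa Xb; have [n [v [+ v0 vn vs ve]]] := segment_samples Xa Xb ltr01.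
rewrite divr1 => nle.
have Xv i : X (v i) by have [] := seg_sub _ _ _ Xa Xb (vs i).
pose P i := (i == n) || (dist_to_set dist (v i) l <= r).
have exP : exists i, P i by exists n; rewrite /P eqxx.
case: (ex_minnP exP) => i Pi imin.
have ile : (i <= n)%N by apply: imin; rewrite /P eqxx.
exists i, (v i); split => //.
- by apply: le_trans nle; rewrite ler_nat.
- exists v; split => // j ji; split => //; right; split.
    by apply: ve; exact: leq_trans ile.
  rewrite leNgt; apply/negP => /ltW vjr.
  by have := imin j; rewrite /P vjr orbT leqNgt ji => /(_ isT).
- by case/orP: Pi => [/eqP ->|?]; [left|right].
Qed.

(** Otherwise a shortcut through [u] would bring [x] closer to [l] than its closest point [p]. *)
Lemma dist_foot (x p u : T) : X x -> X u -> closest_points dist l x p ->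
  dist p u + dist u x = dist p x -> dist p u <= dist_to_set dist u l.
Proof.
move=> Xx Xu [lp xp] pux; have := dist_to_set_lip Xmetric lgeo Xx Xu.
by rewrite -xp (distC Xx Xu) (distC Xx (lX lp)); lra.
Qed.

(** The first part, of length [r], costs about [K r]. Beyond it the points are [r]-far from [l], for
    the same reason as in [dist_foot], and unit steps are allowed. *)
Lemma chain_from_foot (x p u : T) : X x -> X u -> closest_points dist l x p ->
  dist p u + dist u x = dist p x -> exists2 n,
  n%:R <= K * r + dist p u + 2 & chain conformal_step n p u.
Proof.
have [_ seg_sub _ seg_pt] := Xseg.
move=> Xx Xu clp pux; have Xp := lX clp.1.
have [pur|/ltW pur] := leP (dist p u) r.
  have [n nle cn] := chain_segment Xp Xu; exists n => //.
  have : K * dist p u <= K * r by rewrite ler_pM2l.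
  by have := dist_ge0 Xp Xu; lra.
have [|u' su' pu'] := seg_pt p u r Xp Xu; first by rewrite ltW.
have [Xu' pu'u] := seg_sub _ _ _ Xp Xu su'.
have [n nle cn] := chain_segment Xp Xu'.
have [m [v [+ v0 vm vs ve]]] := segment_samples Xu' Xu ltr01.
rewrite divr1 => mle.
exists (n + m)%N.
  by rewrite natrD -pu'u pu'; move: nle; rewrite pu'; have := r0; lra.
apply: chain_cat cn _; exists v; split => // i im.
have [Xvi vi] := seg_sub _ _ _ Xu' Xu (vs i).
have [Xvi' _] := seg_sub _ _ _ Xu' Xu (vs i.+1).
split => //; right; split; first exact: ve.
have := dist_to_set_lip Xmetric lgeo Xx Xvi; case: clp => lp <-.
have := dist_tri Xvi Xu Xx; have := dist_ge0 Xu' Xvi.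
by rewrite (distC Xx Xvi) (distC Xx Xp); lra.
Qed.

(** This is not the reversal of [chain_from_foot]: a conformal step tests the distance to [l] only
    at its starting point. *)
Lemma chain_to_foot (x p u : T) : X x -> X u -> closest_points dist l x p ->
  dist p u + dist u x = dist p x -> exists2 n,
  n%:R <= K * r + dist p u + 2 & chain conformal_step n u p.
Proof.
have [_ seg_sub _ seg_pt] := Xseg.
move=> Xx Xu clp pux; have Xp := lX clp.1.
have [pur|/ltW pur] := leP (dist p u) r.
  have [n nle cn] := chain_segment Xu Xp; exists n => //.
  have : K * dist p u <= K * r by rewrite ler_pM2l.
  by move: nle; have := dist_ge0 Xp Xu; rewrite (distC Xu Xp); lra.
have [|u' su' uu'] := seg_pt u p (dist p u - r) Xu Xp.
  by rewrite (distC Xu Xp); have := r0; lra.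
have [Xu' uu'p] := seg_sub _ _ _ Xu Xp su'.
have [n nle cn] := chain_segment Xu' Xp.
have [m [v [+ v0 vm vs ve]]] := segment_samples Xu Xu' ltr01.
rewrite divr1 => mle.
have u'p : dist u' p = r by move: uu'p; rewrite uu' (distC Xu Xp); lra.
exists (m + n)%N.
  by rewrite natrD; move: nle; rewrite u'p; have := r0; lra.
apply: chain_cat cn; exists v; split => // i im.
have [Xvi vi] := seg_sub _ _ _ Xu Xu' (vs i).
have [Xvi' _] := seg_sub _ _ _ Xu Xu' (vs i.+1).
split => //; right; split; first exact: ve.
have := dist_to_set_lip Xmetric lgeo Xx Xvi; case: clp => lp <-.
have := dist_tri Xx Xu Xvi; have := dist_ge0 Xvi Xu'.
by rewrite (distC Xx Xu) (distC Xx Xp); lra.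
Qed.

(* A chain with the least number of steps is a [(K, 2)]-quasi-geodesic. The
   Morse property keeps it [r]-close to [l], where all steps are short. *)
Lemma morse_chain (M : R -> R -> R) (p q : T) (n : nat) :
  M_morse X dist M l -> M K 2 < r -> l p -> l q ->
  chain conformal_step n p q -> K * dist p q <= n%:R.
Proof.
move=> morM Mr lp lq cn.
have exc : exists m, `[< chain conformal_step m p q >].
  by exists n; apply/asboolP.
case: (ex_minnP exc) => m /asboolP [v [v0 vm vs]] mmin.
have mn : (m <= n)%N by apply: mmin; apply/asboolP.
apply: (@le_trans _ _ m%:R); last by rewrite ler_nat.
have Xv i : (i <= m)%N -> X (v i).
  rewrite leq_eqVlt => /orP[/eqP ->|im]; first by rewrite vm; exact: lX.
  by have [] := vs i im.
have up i j : (i <= j <= m)%N -> dist (v i) (v j) <= j%:R - i%:R.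
  move=> /andP[ij jm]; rewrite -(subnKC ij) natrD (addrC i%:R) addrK.
  have : (i + (j - i) <= m)%N by rewrite subnKC.
  elim: (j - i)%N => [|k IH] ikm.
    by rewrite addn0 dist0//; apply: Xv; lia.
  apply: le_trans (dist_tri (Xv _ _) (Xv (i + k)%N _) (Xv _ _)) _; try lia.
  rewrite -natr1 lerD//; first by apply: IH; lia.
  rewrite addnS; have [|_ _ [iK|[]//]] := vs (i + k)%N; first lia.
  by apply: le_trans iK _; rewrite invf_le1.
(* By minimality of [m], replacing the part from [v i] to [v j] by short steps along the segment
   does not lower the number of steps. *)
have low i j : (i <= j <= m)%N -> j%:R - i%:R <= K * dist (v i) (v j) + 1.
  move=> /andP[ij jm].
  have Xi : X (v i) by apply: Xv; exact: leq_trans jm.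
  have [k kle ck] := chain_segment Xi (Xv _ jm).
  have ci : chain conformal_step i p (v i).
    rewrite -v0 -[i in chain _ i]subn0; apply: chain_sub vs _.
    exact: leq_trans jm.
  have cj : chain conformal_step (m - j) (v j) q.
    by rewrite -vm; apply: chain_sub vs _; rewrite jm leqnn.
  have := mmin (i + k + (m - j))%N.
  have -> : `[< chain conformal_step (i + k + (m - j)) p q >].
    by apply/asboolP; exact: chain_cat (chain_cat ci ck) cj.
  move=> /(_ isT) mle; apply: le_trans kle.
  by rewrite -natrB// ler_nat; lia.
(* In the lower bound, rounding the parameter costs 1 and so does the summand 1 of [low]; hence the
   additive constant 2. *)
have qg : quasi_geodesic X dist K 2 0 m%:R (fun t => v (Num.truncn t)).
  have trm (t : R) : `[0, m%:R]%classic t ->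
      (Num.truncn t)%:R <= t < (Num.truncn t).+1%:R /\ (Num.truncn t <= m)%N.
    rewrite /= in_itv /= => /andP[t0 tm]; rewrite truncn_itv//; split => //.
    by rewrite -(@ler_nat R) (le_trans _ tm)// truncn_le.
  split=> [t tI|s t]; first by apply: Xv; have [] := trm t tI.
  wlog st : s t / s <= t => [wl sI tI|].
    have /orP[st|ts] := le_total s t; first exact: wl.
    rewrite distrC distC; first exact: wl.
      by apply: Xv; have [] := trm s sI.
    by apply: Xv; have [] := trm t tI.
  move=> /trm [/andP[s1 s2] sm] /trm [/andP[t1 t2] tm].
  have stm : (Num.truncn s <= Num.truncn t <= m)%N by rewrite tm le_truncn.
  have := up _ _ stm; have := low _ _ stm.
  move: s1 s2 t1 t2.
  rewrite -!natr1 distrC ger0_norm ?subr_ge0// => s1 s2 t1 t2.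
  move=> lo hi; apply/andP; split.
    rewrite lerBlDr -(ler_pM2l K0) mulrA divff ?gt_eqF// mul1r mulrDr.
    have := K1; lra.
  have : 1 * (t - s) <= K * (t - s) by rewrite ler_wpM2r// subr_ge0.
  lra.
have lv0 : l (v (Num.truncn (0 : R))) by rewrite truncn0 v0.
have lvm : l (v (Num.truncn (m%:R : R))) by rewrite natrK vm.
have close i : (i <= m)%N -> dist_to_set dist (v i) l < r.
  move=> im; apply: le_lt_trans Mr.
  have := morM K 2 0 m%:R _ K1 (ler0n _ _) (ler0n _ _) qg lv0 lvm i%:R.
  by rewrite natrK; apply; rewrite /= in_itv /= ler0n ler_nat.
suff H i : (i <= m)%N -> K * dist p (v i) <= i%:R by rewrite -{1}vm; exact: H.
elim: i => [|i IH] im; first by rewrite v0 dist0 ?mulr0//; exact: lX.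
have [Xi Xi' [iK|[_]]] := vs i im; last by rewrite leNgt close// ltnW.
rewrite -natr1; have := dist_tri (lX lp) Xi Xi'.
rewrite -(ler_pM2l K0) mulrDr => /le_trans; apply.
apply: lerD; first exact: IH (ltnW im).
by rewrite -(mulfV (lt0r_neq0 K0)) ler_pM2l.
Qed.

End MorseGeodesic.

(** * From Morse to contracting *)

Lemma truncate_segment (p x : T) (s : R) : X p -> X x -> 0 <= s ->
  exists u, [/\ X u, seg p x u, dist p u + dist u x = dist p x,
    dist p u <= s & u = x \/ dist p u = s].
Proof.
have [seg_ends seg_sub _ seg_pt] := Xseg.
move=> Xp Xx s0; have [ps|/ltW ps] := leP (dist p x) s.
  exists x; split => //; [by have [] := seg_ends p x Xp Xx| |by left].
  by rewrite dist0// addr0.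
have [|u su pus] := seg_pt p x s Xp Xx; first by rewrite s0.
have [Xu pux] := seg_sub _ _ _ Xp Xx su.
by exists u; split => //; [rewrite pus|right].
Qed.

Hypothesis quad : quadrilateral_property X dist seg.

(** The path has at most [168 r + 41 L + 5] steps and ends at a point of [l] at distance at least
    [L / 2] from [p]. By [morse_chain] it has at least [84 L / 2 = 42 L] steps, so
    [L <= 168 r + 5 < 200 r]. The weight 84 is chosen to beat the coefficient 41. *)
Lemma morse_closest_points (M : R -> R -> R) (l : set T) (r : R) (x y p q : T) :
  geodesic X dist l -> M_morse X dist M l -> M 84 2 < r -> 1 <= r ->
  X x -> X y -> dist x y < dist_to_set dist x l ->
  closest_points dist l x p -> closest_points dist l y q ->
  dist p q <= 200 * r.
Proof.
have [seg_ends seg_sub _ seg_pt] := Xseg.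
move=> lgeo morM Mr r1 Xx Xy xyl clp clq; rewrite leNgt; apply/negP.
have lX := geodesic_sub lgeo.
have Xp := lX _ clp.1; have Xq := lX _ clq.1.
have r0 : 0 < r by lra.
have K1 : (1 : R) <= 84 by lra.
set L := dist p q => rL; have s0 : 0 <= 10 * L by lra.
have [x' [Xx' sx' pxx px's x'E]] := truncate_segment Xp Xx s0.
have [y' [Xy' sy' qyy qy's y'E]] := truncate_segment Xq Xy s0.
have [n1 n1le c1] := chain_from_foot lgeo K1 r0 Xx Xx' clp pxx.
have [n2 [w [n2le sw c2 wE]]] := @chain_far_segment l 84 r x' y' Xx' Xy'.
have [Xw _] := seg_sub _ _ _ Xx' Xy' sw.
have x'y' : dist x' y' <= 21 * L.
  have := dist_tri Xx' Xp Xy'; have := dist_tri Xp Xq Xy'.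
  by rewrite (distC Xx' Xp) -/L; lra.
suff [n3 [c [n3le c3 lc pcL]]] : exists n3 c,
    [/\ n3%:R <= 84 * r + 10 * L + 2, chain (conformal_step l 84 r) n3 w c,
        l c & L / 2 <= dist p c].
  have := morse_chain lgeo K1 r0 morM Mr clp.1 lc
    (chain_cat c1 (chain_cat c2 c3)).
  rewrite !natrD; lra.
case: wE => [->|wr].
  have [n3 n3le c3] := chain_to_foot lgeo K1 r0 Xy Xy' clq qyy.
  exists n3, q; split => //; [lra|by case: clq|by rewrite -/L; lra].
have [c [lc wc]] := closest_points_nonempty Xmetric lgeo Xw.
have Xc := lX _ lc.
have [n3 n3le c3] := @chain_segment l 84 r K1 w c Xw Xc.
exists n3, c; split => //.
  by move: n3le; rewrite wc; lra.
rewrite leNgt; apply/negP => pcL.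
have wcr : dist w c <= r by rewrite wc.
(* Here [d(p, c) < L / 2] and [d(q, c) < 3 L / 2], whereas a truncated point is at distance at least
   [10 L] from [l]. *)
have [||z [Xz xzy zc]] := quad (And4 Xp Xx Xq Xy) Xc sx' sy' sw wcr.
- case: x'E => [|px']; [by left|right].
  have := dist_foot lgeo Xx Xx' clp pxx.
  by have := dist_to_set_le Xmetric lX Xx' lc; lra.
- case: y'E => [|qy']; [by left|right].
  have := dist_foot lgeo Xy Xy' clq qyy.
  have := dist_to_set_le Xmetric lX Xy' lc.
  by have := dist_tri Xq Xp Xc; rewrite (distC Xq Xp) -/L; lra.
(* As [d(x, y) < d(x, l) <= d(x, z) + r + 1], the point [z] is within [r + 1] of [y]. Hence
   [d(y, c) < 2 (r + 1)], so [d(q, c) < 4 (r + 1)], against [d(p, c) < L / 2] and [L > 200 r]. *)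
have := dist_to_set_le Xmetric lX Xx lc; have := dist_tri Xx Xz Xc.
have := dist_to_set_le Xmetric lX Xy lc; have := dist_tri Xy Xz Xc.
rewrite -clq.2 (distC Xy Xz) (distC Xy Xq).
have := dist_tri Xq Xy Xc; have := dist_tri Xp Xc Xq.
by rewrite (distC Xc Xq) -/L; lra.
Qed.

(** Each point of the ball is compared with the centre, as [morse_closest_points] demands; two
    projections are then within twice [200 r] of each other. *)
Lemma morse_contracting (l : set T) : geodesic X dist l ->
  morse X dist l -> contracting X dist l.
Proof.
move=> lgeo [M _ morM]; have lX := geodesic_sub lgeo.
pose r := Num.max (M 84 2 + 1) 1.
have r1 : 1 <= r by rewrite le_max lexx orbT.
have Mr : M 84 2 < r by rewrite lt_max ltrDl ltr01.
exists (400 * r); first lra.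
move=> x s Xx s0 sl; have sx : s <= dist_to_set dist x l.
  exact/(open_ball_disjoint Xmetric lgeo s Xx).
have [p clp] := closest_points_nonempty Xmetric lgeo Xx.
apply: ge_ereal_sup => _ [[q q'] /= [[y [Xy xy] clq] [y' [Xy' xy'] clq']] <-].
have := morse_closest_points lgeo morM Mr r1 Xx Xy (lt_le_trans xy sx) clp clq.
have := morse_closest_points lgeo morM Mr r1 Xx Xy' (lt_le_trans xy' sx)
  clp clq'.
have Xp := lX _ clp.1; have Xq := lX _ clq.1; have Xq' := lX _ clq'.1.
rewrite lee_fin; have := dist_tri Xq Xp Xq'; rewrite (distC Xq Xp); lra.
Qed.

End Segments.

(** * The gauge distance of a convex cone *)

(** Openness is stated along lines, the form in which gauges use it. As sums stay in [C], excluding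
    [0] excludes pairs of opposite vectors. *)
Definition open_convex_cone (R : realType) (n : nat)
    (C : set 'rV[R]_n) : Prop :=
  [/\ forall x y, C x -> C y -> C (x + y),
      forall t x, 0 < t -> C x -> C (t *: x),
      ~ C 0 &
      forall x y, C x -> exists2 e : R, 0 < e & C (x - e *: y)].

(** Gauges are infima, known through the numbers above them; this passes to the product of two
    infima. *)
Lemma ler_mul_of_lt (R : realFieldType) (a b c : R) : 0 < a -> 0 < b ->
  (forall t u, a < t -> b < u -> c <= t * u) -> c <= a * b.
Proof.
move=> a0 b0 H; rewrite leNgt; apply/negP => abc.
have at_ : a < (a + c / b) / 2.
  by have : a < c / b; [rewrite ltr_pdivlMr|lra].
have tb : (a + c / b) / 2 * b < c.
  have -> : (a + c / b) / 2 * b = (a * b + c) / 2 by field; rewrite gt_eqF.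
  lra.
move: at_ tb; set t := (a + c / b) / 2 => at_ tb.
have t0 : 0 < t by lra.
have bu : b < (b + c / t) / 2.
  by have : b < c / t; [rewrite ltr_pdivlMr// mulrC|lra].
have := H _ _ at_ bu.
have -> : t * ((b + c / t) / 2) = (t * b + c) / 2 by field; rewrite gt_eqF.
lra.
Qed.

Lemma ler_mul_quotient (R : realFieldType) (k a b d e f g : R) :
  0 < a -> 0 < b -> 0 < d -> 0 < e -> 0 < g ->
  k * (a * b) * (f * g) <= d * e -> e <= b -> d <= f -> 0 <= k ->
  k * (g * a) <= 1.
Proof.
move=> a0 b0 d0 e0 g0 H eb df k0.
rewrite -(ler_pM2r (mulr_gt0 d0 b0)) mul1r.
have h1 : d * e <= d * b by rewrite ler_pM2l.
apply: le_trans _ (le_trans H h1).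
have -> : k * (g * a) * (d * b) = k * (a * b) * (d * g) by ring.
by rewrite ler_wpM2l ?ler_pM2r// !mulr_ge0// ltW.
Qed.

(** Used as [16 <= e^4] and [4 <= e^2], to convert factors of gauges into additive margins of
    distances. *)
Lemma expR_ge2X (R : realType) (n : nat) : (2 ^ n)%:R <= expR n%:R :> R.
Proof.
rewrite -[n%:R]mulr1 expRM_natl natrX lerXn2r ?nnegrE ?expR_ge0//.
exact: expR_ge1Dx.
Qed.

Ltac row_ring := by apply/rowP => ?; rewrite !mxE; ring.

Section Gauge.
Variables (R : realType) (n : nat) (C : set 'rV[R]_n).
Local Notation V := 'rV[R]_n.
Hypothesis Ccone : open_convex_cone C.

Let C_add : forall x y, C x -> C y -> C (x + y). Proof. by case: Ccone. Qed.
Let C_scale : forall t x, 0 < t -> C x -> C (t *: x).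
Proof. by case: Ccone. Qed.
Let C_not0 : ~ C 0. Proof. by case: Ccone. Qed.
Let C_open : forall x y, C x -> exists2 e : R, 0 < e & C (x - e *: y).
Proof. by case: Ccone. Qed.

Lemma cone_add_scale (t : R) (x y : V) : 0 <= t -> C x -> C y -> C (x + t *: y).
Proof.
rewrite le_eqVlt => /predU1P[<-|t0] Cx Cy; first by rewrite scale0r addr0.
by apply: C_add => //; exact: C_scale.
Qed.

Lemma cone_scale_gt0 (t : R) (x : V) : C x -> C (t *: x) -> 0 < t.
Proof.
move=> Cx Ctx; rewrite ltNge; apply/negP => t0; apply: C_not0.
have := @cone_add_scale (- t) _ _ _ Ctx Cx; rewrite oppr_ge0 => /(_ t0).
by rewrite -scalerDl subrr scale0r.
Qed.

(** Birkhoff's [M(x/y)]: the infimum of the [t] with [x < t y] in the order defined by the cone. *)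
Definition gauge (x y : V) : R := inf [set t | C (t *: y - x)].

Let gauge_set_nonempty x y : C y -> [set t | C (t *: y - x)] !=set0.
Proof.
move=> Cy; have [e e0 Ce] := C_open x Cy.
exists e^-1 => /=.
have := C_scale (t := e^-1); rewrite invr_gt0 => /(_ _ e0 Ce).
by rewrite scalerBr scalerA mulVf ?gt_eqF// scale1r.
Qed.

Let gauge_set_gt0 x y t : C x -> C y -> C (t *: y - x) -> 0 < t.
Proof.
move=> Cx Cy Ct; apply: (cone_scale_gt0 Cy).
by rewrite -(subrK x (t *: y)); apply: C_add.
Qed.

(** Adding multiples of [y] makes the set of admissible [t] upward closed, and openness of [C]
    excludes its infimum. *)
Lemma gaugeP (x y : V) (t : R) : C x -> C y ->
  gauge x y < t <-> C (t *: y - x).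
Proof.
move=> Cx Cy; have lb : has_inf [set t | C (t *: y - x)].
  split; first exact: gauge_set_nonempty.
  by exists 0 => s /= Cs; apply/ltW/(gauge_set_gt0 Cx Cy Cs).
split=> [ht|Ct].
  have [s /= Cs st] := inf_lt lb.1 ht.
  have -> : t *: y - x = s *: y - x + (t - s) *: y by row_ring.
  by apply: cone_add_scale => //; rewrite subr_ge0 ltW.
have [e e0] := C_open y Ct; rewrite addrAC -scalerBl => Cte.
have : gauge x y <= t - e by apply: ge_inf => //; case: lb.
by move=> /le_lt_trans; apply; rewrite ltrBlDr ltrDl.
Qed.

Lemma gauge_le (x y x' y' : V) : C x -> C y -> C x' -> C y' ->
  (forall t, 0 < t -> C (t *: y - x) -> C (t *: y' - x')) ->
  gauge x' y' <= gauge x y.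
Proof.
move=> Cx Cy Cx' Cy' H; rewrite leNgt; apply/negP => lt_g.
have [m1 m2] := midf_lt lt_g.
move/(gaugeP _ Cx Cy) : m1 => m1; move: m2; rewrite ltNge => /negP; apply.
exact/ltW/(gaugeP _ Cx' Cy')/(H _ (gauge_set_gt0 Cx Cy m1)).
Qed.

Lemma gauge_eq (x y : V) (m : R) : C x -> C y ->
  (forall t, m < t <-> C (t *: y - x)) -> gauge x y = m.
Proof.
move=> Cx Cy mP; apply/eqP; rewrite eq_le; apply/andP; split.
  by rewrite leNgt; apply/negP => /mP /(gaugeP _ Cx Cy); rewrite ltxx.
by rewrite leNgt; apply/negP => /(gaugeP _ Cx Cy) /mP; rewrite ltxx.
Qed.

Lemma gauge_ge0 (x y : V) : C x -> C y -> 0 <= gauge x y.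
Proof.
move=> Cx Cy; rewrite leNgt; apply/negP => /(gaugeP _ Cx Cy).
by rewrite scale0r add0r -scaleN1r => /(cone_scale_gt0 Cx); lra.
Qed.

Lemma gauge_mul_gt1 (x y : V) (t u : R) : C x -> C y ->
  gauge x y < t -> gauge y x < u -> 1 < t * u.
Proof.
move=> Cx Cy xyt yxu; have u0 := le_lt_trans (gauge_ge0 Cy Cx) yxu.
move/(gaugeP _ Cx Cy) : xyt => xyt; move/(gaugeP _ Cy Cx) : yxu => yxu.
have := cone_add_scale (ltW u0) yxu xyt.
have -> : u *: x - y + u *: (t *: y - x) = (t * u - 1) *: y by row_ring.
by move/(cone_scale_gt0 Cy); rewrite subr_gt0.
Qed.

Lemma gauge_gt0 (x y : V) : C x -> C y -> 0 < gauge x y.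
Proof.
move=> Cx Cy; have yxu : gauge y x < gauge y x + 1 by rewrite ltrDl.
have u0 := le_lt_trans (gauge_ge0 Cy Cx) yxu.
apply: (@lt_le_trans _ _ (gauge y x + 1)^-1); first by rewrite invr_gt0.
rewrite leNgt; apply/negP => xyt.
by have := gauge_mul_gt1 Cx Cy xyt yxu; rewrite mulVf ?gt_eqF// ltxx.
Qed.

Lemma gauge_mul_ge1 (x y : V) : C x -> C y -> 1 <= gauge x y * gauge y x.
Proof.
move=> Cx Cy; apply: ler_mul_of_lt; rewrite ?gauge_gt0// => t u xt yu.
exact/ltW/(gauge_mul_gt1 Cx Cy xt yu).
Qed.

Lemma gauge_trans (x y z : V) : C x -> C y -> C z ->
  gauge x z <= gauge x y * gauge y z.
Proof.
move=> Cx Cy Cz; apply: ler_mul_of_lt; rewrite ?gauge_gt0// => t u xt yu.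
have t0 := lt_trans (gauge_gt0 Cx Cy) xt.
apply/ltW/(gaugeP _ Cx Cz).
move/(gaugeP _ Cx Cy) : xt => xt; move/(gaugeP _ Cy Cz) : yu => yu.
have -> : (t * u) *: z - x = t *: y - x + t *: (u *: z - y) by row_ring.
by apply: cone_add_scale => //; exact: ltW.
Qed.

Lemma gauge_refl (x : V) : C x -> gauge x x = 1.
Proof.
move=> Cx; apply: gauge_eq => // t.
have -> : t *: x - x = (t - 1) *: x by row_ring.
by rewrite -subr_gt0; split=> [t1|/(cone_scale_gt0 Cx)//]; exact: C_scale.
Qed.

Lemma cone_comb (a b : R) (x y : V) : 0 <= a -> 0 <= b -> 0 < a + b ->
  C x -> C y -> C (a *: x + b *: y).
Proof.
rewrite le_eqVlt => /predU1P[<-|a0] b0 ab Cx Cy.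
  by rewrite scale0r add0r; apply: C_scale => //; move: ab; rewrite add0r.
by apply: cone_add_scale => //; exact: C_scale.
Qed.

Lemma gauge_combl (a b : R) (x y : V) : 0 <= a -> 0 <= b -> 0 < a + b ->
  C x -> C y -> gauge (a *: x + b *: y) y = a * gauge x y + b.
Proof.
move=> a0 b0 ab Cx Cy; have Cz := cone_comb a0 b0 ab Cx Cy.
apply: gauge_eq => // t.
have -> : t *: y - (a *: x + b *: y) = (t - b) *: y - a *: x by row_ring.
move: a0 ab {Cz}; rewrite le_eqVlt => /predU1P[<-|a0] ab.
  rewrite mul0r add0r scale0r subr0 -subr_gt0.
  by split=> [tb|/(cone_scale_gt0 Cy)//]; exact: C_scale.
have -> : (t - b) *: y - a *: x = a *: (((t - b) / a) *: y - x).
  by apply/rowP => ?; rewrite !mxE; field; rewrite gt_eqF.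
rewrite -ltrBrDr -ltr_pdivlMl// (mulrC a^-1).
split=> [/(gaugeP _ Cx Cy) H|H]; first exact: C_scale.
apply/(gaugeP _ Cx Cy); have := C_scale (t := a^-1) _ H.
by rewrite scalerA mulVf ?gt_eqF// scale1r; apply; rewrite invr_gt0.
Qed.

(** Equality in [gauge_trans] along a segment. With [m = gauge x y], what remains is
    [x < t (a x + b y)] for [t > m / (a m + b)]: it reads [(1 - t a) x < t b y], which is clear if
    [t a >= 1] and otherwise follows by dividing. *)
Lemma gauge_combr (a b : R) (x y : V) : 0 <= a -> 0 <= b -> 0 < a + b ->
  C x -> C y ->
  gauge x (a *: x + b *: y) * gauge (a *: x + b *: y) y = gauge x y.
Proof.
move=> a0 b0 ab Cx Cy; have Cz := cone_comb a0 b0 ab Cx Cy.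
apply/eqP; rewrite eq_le gauge_trans// andbT gauge_combl//.
have m0 := gauge_gt0 Cx Cy; set m := gauge x y in m0 *.
have d0 : 0 < a * m + b.
  move: a0 ab {Cz}; rewrite le_eqVlt => /predU1P[<-|a0] ab; first lra.
  by have := mulr_gt0 a0 m0; lra.
rewrite -ler_pdivlMr// leNgt; apply/negP => lt_m.
have [t tm mt] : exists2 t, m / (a * m + b) < t & t < gauge x (a *: x + b *: y).
  by exists ((m / (a * m + b) + gauge x (a *: x + b *: y)) / 2); lra.
have t0 : 0 < t by apply: lt_trans tm; rewrite divr_gt0.
suff /(gaugeP _ Cx Cz) : C (t *: (a *: x + b *: y) - x) by rewrite ltNge ltW.
move: tm; rewrite ltr_pdivrMr// mulrDr mulrA => tm.
have tb0 : 0 <= t * b by rewrite mulr_ge0// ltW.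
have [ta|ta] := leP 1 (t * a).
  have -> : t *: (a *: x + b *: y) - x = (t * a - 1) *: x + (t * b) *: y.
    row_ring.
  apply: cone_comb => //; first by rewrite subr_ge0.
  by move: ta tm; rewrite le_eqVlt => /predU1P[<-|]; lra.
have -> : t *: (a *: x + b *: y) - x =
    (1 - t * a) *: ((t * b / (1 - t * a)) *: y - x).
  by apply/rowP => ?; rewrite !mxE; field; rewrite gt_eqF// subr_gt0.
apply: C_scale; first by rewrite subr_gt0.
by apply/(gaugeP _ Cx Cy); rewrite ltr_pdivlMr ?subr_gt0// -/m; lra.
Qed.

(** Birkhoff's form of the Hilbert metric. *)
Definition cone_dist (x y : V) : R := 2^-1 * ln (gauge x y * gauge y x).

Lemma gauge_mulE (x y : V) : C x -> C y ->
  gauge x y * gauge y x = expR (2 * cone_dist x y).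
Proof.
move=> Cx Cy; rewrite /cone_dist mulrA mulfV ?mul1r ?pnatr_eq0// lnK//.
by rewrite posrE mulr_gt0// gauge_gt0.
Qed.

Lemma cone_dist_le (x y : V) (r : R) : C x -> C y ->
  gauge x y * gauge y x <= expR (2 * r) -> cone_dist x y <= r.
Proof. by move=> Cx Cy; rewrite gauge_mulE// ler_expR ler_pM2l. Qed.

Lemma cone_distC (x y : V) : cone_dist x y = cone_dist y x.
Proof. by rewrite /cone_dist mulrC [gauge y x * _]mulrC mulrC. Qed.

Lemma cone_dist_refl (x : V) : C x -> cone_dist x x = 0.
Proof. by move=> Cx; rewrite /cone_dist gauge_refl// mulr1 ln1 mulr0. Qed.

Lemma cone_dist_ge0 (x y : V) : C x -> C y -> 0 <= cone_dist x y.
Proof. by move=> Cx Cy; rewrite mulr_ge0// ln_ge0// gauge_mul_ge1. Qed.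

Lemma cone_dist_trans (x y z : V) : C x -> C y -> C z ->
  cone_dist x z <= cone_dist x y + cone_dist y z.
Proof.
move=> Cx Cy Cz; apply: cone_dist_le => //; rewrite mulrDr expRD -!gauge_mulE//.
rewrite mulrACA [gauge y x * _]mulrC.
by apply: ler_pM; rewrite ?gauge_trans// ltW// gauge_gt0.
Qed.

(** By the triangle inequality it suffices that [s x] and [x] are at distance 0; their two gauges
    are [s] and [s^-1]. *)
Lemma cone_dist_scale (s : R) (x y : V) : 0 < s -> C x -> C y ->
  cone_dist (s *: x) y = cone_dist x y.
Proof.
move=> s0 Cx Cy; have Csx := C_scale s0 Cx.
have sx0 : cone_dist (s *: x) x = 0.
  have -> : cone_dist (s *: x) x = 2^-1 * ln (s * s^-1).
    congr (_ * ln (_ * _)); apply: gauge_eq => // t.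
      have -> : t *: x - s *: x = (t - s) *: x by row_ring.
      by rewrite -subr_gt0; split=> [?|/(cone_scale_gt0 Cx)//]; exact: C_scale.
    have -> : t *: (s *: x) - x = (t * s - 1) *: x by row_ring.
    rewrite -[s^-1]div1r ltr_pdivrMr// -subr_gt0.
    by split=> [?|/(cone_scale_gt0 Cx)//]; exact: C_scale.
  by rewrite mulfV ?gt_eqF// ln1 mulr0.
have := cone_dist_trans Csx Cx Cy; have := cone_dist_trans Cx Csx Cy.
rewrite (cone_distC x (s *: x)) sx0 !add0r => ? ?.
by apply/eqP; rewrite eq_le; apply/andP.
Qed.

Lemma cone_dist_comb (a b : R) (x y : V) : 0 <= a -> 0 <= b -> 0 < a + b ->
  C x -> C y ->
  cone_dist x (a *: x + b *: y) + cone_dist (a *: x + b *: y) y = cone_dist x y.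
Proof.
move=> a0 b0 ab Cx Cy; have Cz := cone_comb a0 b0 ab Cx Cy.
have := gauge_combr a0 b0 ab Cx Cy; have := gauge_combr b0 a0 _ Cy Cx.
rewrite (addrC b a) (addrC (b *: y)) => /(_ ab).
set z := _ + _ in Cz *; move=> yzx xzy.
rewrite /cone_dist -mulrDr -lnM ?posrE ?mulr_gt0 ?gauge_gt0//.
by rewrite mulrACA xzy (mulrC (gauge z x)) yzx.
Qed.

Lemma cone_dist_point (t : R) (x y : V) : C x -> C y ->
  0 <= t <= cone_dist x y -> exists a b : R,
    [/\ 0 <= a, 0 <= b, a + b = 1 & cone_dist x (a *: x + b *: y) = t].
Proof.
move=> Cx Cy /andP[t0 txy].
have m0 := gauge_gt0 Cx Cy; have m'0 := gauge_gt0 Cy Cx.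
have E1 : 1 <= expR (2 * t) by rewrite -expR0 ler_expR mulr_ge0.
have Emm : expR (2 * t) <= gauge x y * gauge y x.
  by rewrite gauge_mulE// ler_expR ler_pM2l.
pose E := expR (2 * t); pose m := gauge x y; pose m' := gauge y x.
have a0 : 0 <= m * m' - E by rewrite subr_ge0.
have b0 : 0 <= m * (E - 1) by rewrite mulr_ge0 ?subr_ge0// ltW.
(* These weights solve [gauge x z * gauge z x = E] for [z = a x + b y], given
   [gauge x z = m / (a m + b)] and [gauge z x = a + b m'] after normalization to [a + b = 1]. *)
set a := m * m' - E in a0; set b := m * (E - 1) in b0.
(* Both weights vanish only if [E = 1], that is, [t = 0]; the point is then [x]. *)
have := addr_ge0 a0 b0; rewrite le_eqVlt => /predU1P[/esym/eqP|ab].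
  rewrite paddr_eq0// => /andP[/eqP aE /eqP bE].
  exists 1, 0; split; rewrite ?addr0// scale1r scale0r addr0 cone_dist_refl//.
  have /eqP : b = 0 by [].
  rewrite mulf_eq0 gt_eqF//= subr_eq0 /E -[X in _ == X]expR0.
  by move=> /eqP/expR_inj; lra.
exists (a / (a + b)), (b / (a + b)).
have a'0 : 0 <= a / (a + b) by rewrite divr_ge0// ltW.
have b'0 : 0 <= b / (a + b) by rewrite divr_ge0// ltW.
have ab1 : a / (a + b) + b / (a + b) = 1 by rewrite -mulrDl mulfV// gt_eqF.
split => //; set a' := a / _ in a'0 ab1 *; set b' := b / _ in b'0 ab1 *.
have ab'0 : 0 < a' + b' by rewrite ab1.
have Cz := cone_comb a'0 b'0 ab'0 Cx Cy.
have xzy := gauge_combr a'0 b'0 ab'0 Cx Cy.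
have zy := gauge_combl a'0 b'0 ab'0 Cx Cy.
have := @gauge_combl b' a' y x b'0 a'0; rewrite (addrC b') (addrC (b' *: y)).
move=> /(_ ab'0 Cy Cx) zx.
set z := _ + _ in Cz xzy zy zx *.
have zy0 := gauge_gt0 Cz Cy.
suff : expR (2 * cone_dist x z) = E by move=> /expR_inj; lra.
rewrite -gauge_mulE//.
have -> : gauge x z = m / gauge z y by rewrite /m -xzy mulfK// gt_eqF.
rewrite mulrAC; apply/(canLR (mulfK _)); first by rewrite gt_eqF.
rewrite zx zy -/m -/m' /a' /b' /a /b; field.
by rewrite gt_eqF.
Qed.

(* Since [a p] is below [x'] and [x'] below [w], the bounds on the distances to
   [c] make [a p] a small multiple of [c], measured at the scale of [w]. *)
Lemma gauge_summand_small (a b e r : R) (p x y c x' w : V) :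
  0 < a -> 0 <= b -> 0 <= e -> C p -> C x -> C y -> C c ->
  x' = a *: p + b *: x -> w = x' + e *: y ->
  cone_dist w c <= r -> cone_dist p c + r + 2 <= cone_dist x' c ->
  16 * (gauge c w * gauge (a *: p) c) <= 1.
Proof.
move=> a0 b0 e0 Cp Cx Cy Cc x'E wE wr; have CP := C_scale a0 Cp.
rewrite -(cone_dist_scale a0 Cp Cc); set P := a *: p in CP x'E * => px'.
have Cx' : C x' by rewrite x'E; exact: cone_add_scale.
have Cw : C w by rewrite wE; exact: cone_add_scale.
have cx'P : gauge c x' <= gauge c P.
  apply: gauge_le => // t t0 ctP.
  have -> : t *: x' - c = t *: P - c + (t * b) *: x by rewrite x'E; row_ring.
  by apply: cone_add_scale => //; rewrite mulr_ge0// ltW.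
have x'wc : gauge x' c <= gauge w c.
  apply: gauge_le => // t t0 ctw.
  have -> : t *: c - x' = t *: c - w + e *: y by rewrite wE; row_ring.
  exact: cone_add_scale.
(* The additive margin 2 of the hypothesis becomes the factor [e^4 >= 16]. *)
have e16 : 16 * expR (2 * cone_dist P c) * expR (2 * cone_dist w c)
    <= expR (2 * cone_dist x' c).
  apply: (@le_trans _ _
    (expR 4 * expR (2 * cone_dist P c) * expR (2 * cone_dist w c))).
    by rewrite !ler_pM2r ?expR_gt0// (@expR_ge2X R 4).
  by rewrite -!expRD ler_expR; lra.
have Pc := gauge_mulE CP Cc; have x'c := gauge_mulE Cx' Cc.
have wc := gauge_mulE Cw Cc.
have gPc := gauge_gt0 CP Cc; have gcP := gauge_gt0 Cc CP.
have gx'c := gauge_gt0 Cx' Cc; have gcx' := gauge_gt0 Cc Cx'.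
have gwc := gauge_gt0 Cw Cc; have gcw := gauge_gt0 Cc Cw.
move: e16; rewrite -Pc -x'c -wc => e16.
exact: ler_mul_quotient gPc gcP gx'c gcx' gcw e16 cx'P x'wc (ler0n _ 16).
Qed.

(** Write [w = P + Q + z] and [t = 2 gauge c w], so that [t w > c]. Both [t P] and [t Q] are below
    [c / 4], hence [t z > c / 2] and [gauge c z <= 4 gauge c w]. Since [z] is below [w], also
    [gauge z c <= gauge w c]. The factor [4 <= e^2] costs 1 in the distance. *)
Lemma cone_quadrilateral (r a1 b1 a2 b2 a3 b3 : R) (p x q y x' y' w c : V) :
  C p -> C x -> C q -> C y -> C c ->
  [/\ 0 <= a1, 0 <= b1 & a1 + b1 = 1] -> x' = a1 *: p + b1 *: x ->
  [/\ 0 <= a2, 0 <= b2 & a2 + b2 = 1] -> y' = a2 *: q + b2 *: y ->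
  [/\ 0 <= a3, 0 <= b3 & a3 + b3 = 1] -> w = a3 *: x' + b3 *: y' ->
  cone_dist w c <= r ->
  x' = x \/ cone_dist p c + r + 2 <= cone_dist x' c ->
  y' = y \/ cone_dist q c + r + 2 <= cone_dist y' c ->
  exists a b : R, [/\ 0 <= a, 0 <= b, a + b = 1 &
    cone_dist (a *: x + b *: y) c <= r + 1].
Proof.
move=> Cp Cx Cq Cy Cc ab1 x'E ab2 y'E [a30 b30 ab3] wE wr hx hy.
have comb1 (a b : R) u v : C u -> C v -> [/\ 0 <= a, 0 <= b & a + b = 1] ->
    C (a *: u + b *: v).
  by move=> Cu Cv [a0 b0 ab]; apply: cone_comb => //; rewrite ab.
have Cx' : C x' by rewrite x'E; exact: comb1.
have Cy' : C y' by rewrite y'E; exact: comb1.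
have Cw : C w by rewrite wE; exact: comb1.
pose t := 2 * gauge c w.
have gcw := gauge_gt0 Cc Cw; have gwc := gauge_gt0 Cw Cc.
have t0 : 0 < t by rewrite mulr_gt0.
have Ctw : C (t *: w - c) by apply/(gaugeP _ Cc Cw); rewrite /t; lra.
(* Serves [P] and [Q] alike; when [u' = v] the summand along [u] is 0. *)
have small : forall (d e a b : R) (u v u' v' : V), C u -> C v -> C v' ->
    [/\ 0 <= a, 0 <= b & a + b = 1] -> u' = a *: u + b *: v ->
    0 <= d -> 0 <= e -> w = d *: u' + e *: v' ->
    u' = v \/ cone_dist u c + r + 2 <= cone_dist u' c ->
  exists f g, [/\ 0 <= f, 0 <= g, d *: u' = f *: u + g *: v &
    C (4^-1 *: c - t *: (f *: u))].
  move=> d e a b u v u' v' Cu Cv Cv' [a0 b0 ab] u'E d0 e0 wE'.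
  have C4 : C (4^-1 *: c) by exact: C_scale.
  move=> [->|hu].
    by exists 0, d; rewrite scale0r add0r scaler0 subr0; split.
  exists (d * a), (d * b); split; rewrite ?mulr_ge0//.
    by rewrite u'E scalerDr !scalerA.
  have := mulr_ge0 d0 a0; rewrite le_eqVlt => /predU1P[<-|da0].
    by rewrite scale0r scaler0 subr0.
  have dp : 0 < d.
    rewrite lt_neqAle d0 andbT; apply: contraTneq da0 => <-.
    by rewrite mul0r ltxx.
  have Cu' : C u' by rewrite u'E; exact: comb1.
  have du'E : d *: u' = (d * a) *: u + (d * b) *: v.
    by rewrite u'E scalerDr !scalerA.
  have := gauge_summand_small da0 (mulr_ge0 d0 b0) e0 Cu Cv Cv' Cc du'E wE' wr.
  rewrite cone_dist_scale// => /(_ hu) H16.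
  have CP : C ((d * a) *: u) by exact: C_scale.
  have : gauge ((d * a) *: u) c < (4 * t)^-1.
    rewrite -[(4 * t)^-1]div1r ltr_pdivlMr ?mulr_gt0// /t.
    by have := mulr_gt0 gcw (gauge_gt0 CP Cc); lra.
  move=> /(gaugeP _ CP Cc) /(C_scale t0).
  congr C; apply/rowP => ?; rewrite !mxE; field; by rewrite gt_eqF.
have [f1 [g1 [f10 g10 x'fg CP]]] :=
  small _ _ _ _ _ _ _ _ Cp Cx Cy' ab1 x'E a30 b30 wE hx.
have wE' : w = b3 *: y' + a3 *: x' by rewrite wE addrC.
have [f2 [g2 [f20 g20 y'fg CQ]]] :=
  small _ _ _ _ _ _ _ _ Cq Cy Cx' ab2 y'E b30 a30 wE' hy.
pose z := g1 *: x + g2 *: y.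
have wz : w = z + f1 *: p + f2 *: q by rewrite wE x'fg y'fg /z; row_ring.
have Ctz : C (t *: z - 2^-1 *: c).
  have -> : t *: z - 2^-1 *: c = t *: w - c + (4^-1 *: c - t *: (f1 *: p)) +
      (4^-1 *: c - t *: (f2 *: q)).
    by rewrite wz; apply/rowP => ?; rewrite !mxE; field.
  exact: C_add (C_add Ctw CP) CQ.
have g0 : 0 < g1 + g2.
  have := addr_ge0 g10 g20; rewrite le_eqVlt => /predU1P[/esym/eqP|//].
  rewrite paddr_eq0// => /andP[/eqP g1E /eqP g2E].
  move: Ctz; rewrite /z g1E g2E !scale0r addr0 scaler0 sub0r -scaleNr.
  by move/(cone_scale_gt0 Cc); lra.
have Cz : C z by exact: cone_comb.
have zc : gauge c z <= 2 * t.
  apply/ltW/(gaugeP _ Cc Cz); have := C_scale (t := 2) (ltr0n _ 2) Ctz.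
  by congr C; apply/rowP => ?; rewrite !mxE; field.
have cz : gauge z c <= gauge w c.
  apply: gauge_le => // s s0 csw.
  have -> : s *: c - z = s *: c - w + f1 *: p + f2 *: q by rewrite wz; row_ring.
  by do 2!apply: cone_add_scale => //.
have dz : cone_dist z c <= r + 1.
  apply: cone_dist_le => //; rewrite mulrDr mulr1 expRD.
  apply: (@le_trans _ _ (gauge w c * (4 * gauge c w))).
    apply: ler_pM => //; first by rewrite ltW// gauge_gt0.
      by rewrite ltW// gauge_gt0.
    by move: zc; rewrite /t; lra.
  rewrite mulrCA mulrC gauge_mulE//; apply: ler_pM; rewrite ?expR_ge0//.
    by rewrite ler_expR ler_pM2l.
  exact: (@expR_ge2X R 2).
exists (g1 / (g1 + g2)), (g2 / (g1 + g2)).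
split; [by rewrite divr_ge0// ltW|by rewrite divr_ge0// ltW| |].
  by rewrite -mulrDl mulfV// gt_eqF.
by rewrite !(mulrC _ (_ + _)^-1) -!scalerA -scalerDr cone_dist_scale ?invr_gt0.
Qed.

End Gauge.

(** * Hilbert geometry *)

Section ChartCoordinates.
Variables (R : realType) (d : nat) (phi : 'cV[R]_d).
Local Notation form := (linear_form phi).
Local Notation coord := (chart_coord phi).

Lemma linear_formD (u v : 'rV[R]_d) : form (u + v) = form u + form v.
Proof. by rewrite /linear_form mulmxDl mxE. Qed.

Lemma linear_formZ (t : R) (v : 'rV[R]_d) : form (t *: v) = t * form v.
Proof. by rewrite /linear_form -scalemxAl mxE. Qed.

Lemma linear_formB (u v : 'rV[R]_d) : form (u - v) = form u - form v.
Proof. by rewrite linear_formD -scaleN1r linear_formZ mulN1r. Qed.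

Lemma linear_form_continuous : continuous form.
Proof.
have -> : form = fun v => \sum_j v 0 j * phi j 0.
  by apply/funext => v; rewrite /linear_form mxE.
elim: (index_enum _) => [|j r IH].
  rewrite (_ : (fun=> _) = fun=> 0); first exact: cst_continuous.
  by apply/funext => v; rewrite big_nil.
rewrite (_ : (fun=> _) = fun v : 'rV[R]_d =>
    v 0 j * phi j 0 + \sum_(i <- r) v 0 i * phi i 0).
  move=> v; apply: (@cvgD _ _ _ (nbhs v)); last exact: IH.
  apply: (@cvgM _ _ (nbhs v)); first exact: coord_continuous.
  exact: cvg_cst.
by apply/funext => v; rewrite big_cons.
Qed.

Lemma projective_line (p : projective R d) : val p = <[vpick (val p)]>%VS.
Proof.
apply/esym/eqP; rewrite eqEdim -memvE memv_pick dim_vline (eqP (valP p)).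
by rewrite vpick0 -dimv_eq0 (eqP (valP p)).
Qed.

Lemma form1_neq0 (v : 'rV[R]_d) : form v = 1 -> v != 0.
Proof.
move=> v1; apply: contra_eq_neq v1 => ->.
by rewrite /linear_form mul0mx mxE eq_sym oner_neq0.
Qed.

Lemma chart_coord_eq (p : projective R d) (v : 'rV[R]_d) :
  v \in val p -> form v = 1 -> coord p = v.
Proof.
rewrite [in v \in _]projective_line => /vlineP[k ->] kv.
rewrite /chart_coord; congr (_ *: _).
have := form1_neq0 kv; rewrite scaler_eq0 negb_or => /andP[k0 _].
move: kv; rewrite linear_formZ => kv.
have f0 : form (vpick (val p)) != 0.
  by apply: contra_eq_neq kv => ->; rewrite mulr0 eq_sym oner_neq0.
by apply: (mulIf f0); rewrite mulVf.
Qed.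

Lemma chart_coordP (p : projective R d) : affine_chart phi p ->
  coord p \in val p /\ form (coord p) = 1.
Proof.
rewrite /affine_chart /= projective_line => -[_ /vlineP[k ->]].
rewrite linear_formZ mulf_eq0 negb_or => /andP[_ v0].
split; first by rewrite memvZ// -projective_line memv_pick.
by rewrite linear_formZ mulVf.
Qed.

Lemma chart_coord_inj (p q : projective R d) : affine_chart phi p ->
  affine_chart phi q -> coord p = coord q -> p = q.
Proof.
move=> /chart_coordP[pp p1] /chart_coordP[qq _] pq.
by apply: line_unique (form1_neq0 p1) pp _; rewrite pq.
Qed.

Lemma projective_of_vector (v : 'rV[R]_d) : v != 0 ->
  exists p : projective R d, v \in val p.
Proof.
move=> v0; have dv : \dim <[v]>%VS == 1%N by rewrite dim_vline v0.
by exists (exist _ <[v]>%VS dv) => /=; exact: memv_line.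
Qed.

Lemma form_neq0 (p : projective R d) (v : 'rV[R]_d) : affine_chart phi p ->
  v \in val p -> v != 0 -> form v != 0.
Proof.
move=> [u up u0] vp v0; have vE : <[v]>%VS = val p.
  by apply/eqP; rewrite eqEdim -memvE vp dim_vline v0 (eqP (valP p)).
move: up u0; rewrite -vE => /vlineP[k ->].
by rewrite linear_formZ mulf_eq0 negb_or => /andP[].
Qed.

Lemma memv_chart_coord (p : projective R d) (v : 'rV[R]_d) :
  v \in val p -> form v != 0 -> coord p = (form v)^-1 *: v.
Proof.
move=> vp v0; apply: chart_coord_eq; first exact: memvZ.
by rewrite linear_formZ mulVf.
Qed.

End ChartCoordinates.

(** * The cone over a properly convex domain *)

Section ConvexDomain.
Variables (R : realType) (d : nat) (phi : 'cV[R]_d).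
Variable Omega : set (projective R d).
Hypothesis Om : properly_convex_in phi Omega.
Local Notation form := (linear_form phi).
Local Notation coord := (chart_coord phi).

Let Om_open : open Omega. Proof. by case: Om. Qed.
Let Om_convex : convex_in_chart phi Omega. Proof. by case: Om. Qed.
Let Om_chart : Omega `<=` affine_chart phi. Proof. by case: Om_convex. Qed.
Let cl_chart : closure Omega `<=` affine_chart phi.
Proof. by case: Om => _ _ _ _ []. Qed.

(** The punctured cone consists of two opposite halves; the sign of [phi] selects one. *)
Definition domain_cone : set 'rV[R]_d :=
  [set v | 0 < form v] `&` punctured_cone Omega.

Lemma domain_coneE (v : 'rV[R]_d) : domain_cone v <->
  exists2 p, Omega p & exists2 t, 0 < t & v = t *: coord p.
Proof.
split=> [[v0 [vn0 [p Op vp]]]|[p Op [t t0 ->]]].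
  exists p => //; exists (form v) => //.
  by rewrite (memv_chart_coord vp) ?gt_eqF// scalerA mulfV ?gt_eqF// scale1r.
have [pp p1] := chart_coordP (Om_chart Op).
split; first by rewrite /= linear_formZ p1 mulr1.
split; first by rewrite scaler_eq0 gt_eqF//= (form1_neq0 p1).
by exists p => //; rewrite memvZ.
Qed.

Lemma domain_cone_coord (p : projective R d) : Omega p -> domain_cone (coord p).
Proof.
move=> Op; apply/domain_coneE; exists p => //.
by exists 1; rewrite ?scale1r.
Qed.

Lemma domain_cone_form1 (v : 'rV[R]_d) : domain_cone v -> form v = 1 ->
  exists2 p, Omega p & coord p = v.
Proof.
move=> [v0 [vn0 [p Op vp]]] v1; exists p => //.
exact: chart_coord_eq.
Qed.

Lemma domain_cone_open : open domain_cone.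
Proof.
apply: openI; last exact: Om_open.
apply: (@open_comp _ _ form [set t : R | 0 < t]); last exact: open_gt.
by move=> v _; exact: linear_form_continuous.
Qed.

Lemma coord_convex (a b : R) (p q : projective R d) : Omega p -> Omega q ->
  0 <= a -> 0 <= b -> a + b = 1 ->
  exists2 r, Omega r & coord r = a *: coord p + b *: coord q.
Proof.
move=> Op Oq a0 b0 ab.
have [_ cvx] := Om_convex.
have a1 : a <= 1 by lra.
have := cvx _ _ (Itv01 a0 a1)
  (mem_set (imageP coord Op)) (mem_set (imageP coord Oq)).
rewrite inE => -[r Or rE]; exists r => //; rewrite rE.
have -> : b = 1 - a by lra.
by [].
Qed.

Lemma domain_cone_convex : open_convex_cone domain_cone.
Proof.
split.
- move=> _ _ /domain_coneE[p Op [s s0 ->]] /domain_coneE[q Oq [t t0 ->]].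
  have st : 0 < s + t by rewrite addr_gt0.
  have [r Or rE] : exists2 r, Omega r &
      coord r = (s / (s + t)) *: coord p + (t / (s + t)) *: coord q.
    apply: coord_convex => //; try by rewrite divr_ge0// ltW.
    by rewrite -mulrDl mulfV// gt_eqF.
  apply/domain_coneE; exists r => //; exists (s + t) => //.
  by rewrite rE scalerDr !scalerA !(mulrC (s + t)) !divfK// gt_eqF.
- move=> t x t0 /domain_coneE[p Op [s s0 ->]].
  apply/domain_coneE; exists p => //.
  by exists (t * s); rewrite ?mulr_gt0// scalerA.
- by move=> [_ [/eqP]].
- move=> x y Cx; have := domain_cone_open; rewrite openE => /(_ _ Cx).
  have : (fun e : R => x - e *: y) @ 0 --> x.
    rewrite -[X in _ --> X](subr0 x) -(scale0r y).
    by apply: cvgB; [exact: cvg_cst|exact: scalel_continuous].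
  move=> /[apply]; rewrite /nbhs/= => /nbhs_ballP[e /= e0 eb].
  exists (e / 2); first by rewrite divr_gt0.
  apply: eb; rewrite /ball /= sub0r normrN gtr0_norm ?divr_gt0//; lra.
Qed.

Let C_cone := domain_cone_convex.

(** For [p] in [Omega] close enough to [a], the vector [coord a + y - coord p] is still in the open
    cone; adding [coord p] gives the claim. *)
Lemma closure_add_cone (a : projective R d) (y : 'rV[R]_d) :
  closure Omega a -> domain_cone y -> domain_cone (coord a + y).
Proof.
move=> cla Cy; have [aa a1] := chart_coordP (cl_chart cla).
pose U : set (projective R d) :=
  [set p | affine_chart phi p /\ domain_cone (coord a + y - coord p)].
have U_open : open U.
  rewrite /open /= /projective_open.
  rewrite (_ : punctured_cone U = [set v | form v != 0 /\
      domain_cone (coord a + y - (form v)^-1 *: v)]).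
    rewrite openE => v [v0 Cv]; apply: filterI.
      have nz : nbhs (form v) [set t : R | t != 0].
        by apply: open_nbhs_nbhs; split => //; exact: open_neq.
      exact: (linear_form_continuous nz).
    have Co := open_nbhs_nbhs (conj domain_cone_open Cv).
    suff : (fun u => coord a + y - (form u)^-1 *: u) @ v -->
        coord a + y - (form v)^-1 *: v.
      by move/(_ _ Co).
    apply: (@cvgB _ _ _ (nbhs v)); first exact: cvg_cst.
    apply: (@cvgZ _ _ _ (nbhs v)); last exact: cvg_id.
    by apply: (@cvgV _ _ (nbhs v)) => //; exact: linear_form_continuous.
  apply/seteqP; split=> v.
    move=> [v0 [p [cp Cp] vp]]; split; first exact: form_neq0 cp vp v0.
    by rewrite -(memv_chart_coord vp)//; exact: form_neq0 cp vp v0.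
  move=> [v0 Cv]; have vn0 : v != 0.
    by apply: contraNneq v0 => ->; rewrite /linear_form mul0mx mxE.
  split => //; have [p vp] := projective_of_vector vn0; exists p => //.
  by split; [exists v|rewrite (memv_chart_coord vp)].
have Ua : U a by split; [exact: cl_chart|rewrite addrAC subrr add0r].
have [p [Op [_ Cp]]] : Omega `&` U !=set0.
  by apply: cla; apply: open_nbhs_nbhs.
rewrite -(subrK (coord p) (coord a + y)).
by have [C_add _ _ _] := C_cone; apply: C_add => //; exact: domain_cone_coord.
Qed.

(** The vector [(1 + tau^-1) x - y] equals [tau^-1 coord a], so it lies on the boundary of the cone.
    Larger coefficients of [x] lead into the cone by [closure_add_cone]; a smaller or equal one
    inside it would put [a] in [Omega]. *)
Lemma frontier_gauge (x y : 'rV[R]_d) (a : projective R d) (tau : R) :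
  domain_cone x -> domain_cone y -> 0 < tau -> frontier Omega a ->
  coord a = x - tau *: (y - x) -> gauge domain_cone y x = 1 + tau^-1.
Proof.
move=> Cx Cy tau0 [cla nOa] aE; have [C_add C_scale _ _] := C_cone.
have aE' : (1 + tau^-1) *: x - y = tau^-1 *: coord a.
  by rewrite aE; apply/rowP => ?; rewrite !mxE; field; rewrite gt_eqF.
apply: (gauge_eq C_cone Cy Cx) => t; split=> [tt|Ct].
  have t0 : 0 < tau * (t - (1 + tau^-1)) by rewrite mulr_gt0// subr_gt0.
  have := C_scale tau^-1 _ _ (closure_add_cone cla (C_scale _ _ t0 Cx)).
  rewrite invr_gt0 scalerDr -aE' => /(_ tau0).
  by congr domain_cone; apply/rowP => ?; rewrite !mxE; field; rewrite gt_eqF.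
rewrite ltNge; apply/negP => tt; apply: nOa.
have : domain_cone ((1 + tau^-1) *: x - y).
  have -> : (1 + tau^-1) *: x - y = t *: x - y + (1 + tau^-1 - t) *: x.
    row_ring.
  by apply: (cone_add_scale C_cone) => //; rewrite subr_ge0.
rewrite aE' => /(C_scale _ _ tau0).
rewrite scalerA mulfV ?gt_eqF// scale1r => Ca.
have [_ a1] := chart_coordP (cl_chart cla).
have [p Op pa] := domain_cone_form1 Ca a1.
rewrite (_ : Omega^° = Omega); last exact/interior_id.
by rewrite -(chart_coord_inj (Om_chart Op) (cl_chart cla) pa).
Qed.

(** Otherwise the whole ray from [x] in the direction [x - y] would lie in the chart image of
    [Omega], which is bounded. *)
Lemma gauge_gt1 (x y : 'rV[R]_d) : domain_cone x -> domain_cone y ->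
  form x = 1 -> form y = 1 -> x != y -> 1 < gauge domain_cone y x.
Proof.
move=> Cx Cy x1 y1 xy; have [_ C_scale _ _] := C_cone.
rewrite ltNge; apply/negP => m1.
have [_ [M [_ bM]]] : bounded_in_chart phi (closure Omega) by case: Om.
have MP v : domain_cone v -> form v = 1 -> `|v| <= M + 1.
  move=> Cv v1; have [p Op <-] := domain_cone_form1 Cv v1.
  have := bM (M + 1); rewrite ltrDl => /(_ ltr01); apply.
  by exists p => //; exact: subset_closure.
have yx0 : 0 < `|y - x| by rewrite normr_gt0 subr_eq0 eq_sym.
(* Chosen so that [x - tau (y - x)] has norm at least [M + 2]. *)
pose tau := (M + 1 + `|x| + 1) / `|y - x|.
have M0 : 0 <= M + 1 by apply: le_trans (MP x Cx x1).
have tau0 : 0 < tau by rewrite divr_gt0//; have := normr_ge0 x; lra.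
have Cv : domain_cone (x - tau *: (y - x)).
  have /(gaugeP C_cone _ Cy Cx) /(C_scale _ _ tau0) :
      gauge domain_cone y x < 1 + tau^-1.
    by apply: le_lt_trans m1 _; rewrite ltrDl invr_gt0.
  by congr domain_cone; apply/rowP => ?; rewrite !mxE; field; rewrite gt_eqF.
have := MP _ Cv.
rewrite linear_formB linear_formZ linear_formB x1 y1 subrr mulr0 subr0.
move=> /(_ erefl); rewrite leNgt => /negP; apply.
rewrite distrC; apply: lt_le_trans (lerB_dist _ _).
by rewrite normrZ gtr0_norm// /tau divfK ?gt_eqF//; lra.
Qed.

(** With [m = gauge y x], the vector [m x - y] is outside the cone by [gaugeP], but adding any
    positive multiple of [x] leads into it. The form [phi] takes the value [m - 1 > 0] on it, whence
    [tau]. *)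
Lemma frontier_exists (x y : 'rV[R]_d) : domain_cone x -> domain_cone y ->
  form x = 1 -> form y = 1 -> x != y -> exists a tau,
  [/\ 0 < tau, frontier Omega a & coord a = x - tau *: (y - x)].
Proof.
move=> Cx Cy x1 y1 xy; have [_ C_scale _ _] := C_cone.
have m1 := gauge_gt1 Cx Cy x1 y1 xy.
set m := gauge domain_cone y x in m1; pose tau := (m - 1)^-1.
have tau0 : 0 < tau by rewrite invr_gt0 subr_gt0.
pose v := x - tau *: (y - x).
have vE t : (1 + t) *: v = tau *: (m *: x - y) + t *: v.
  by apply/rowP => ?; rewrite !mxE /tau; field; lra.
have vm : v = tau *: (m *: x - y).
  by apply/rowP => ?; rewrite !mxE /tau; field; lra.
have v1 : form v = 1.
  by rewrite linear_formB linear_formZ linear_formB x1 y1 subrr mulr0 subr0.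
have vn0 := form1_neq0 v1.
have [a va] := projective_of_vector vn0.
exists a, tau; split => //; last exact: chart_coord_eq.
split.
  move=> B; rewrite nbhsE => -[U [oU Ua] UB].
  have Uv : punctured_cone U v by split => //; exists a.
  have nU : nbhs v (punctured_cone U) by exact: open_nbhs_nbhs.
  have : (fun e : R => v + e *: x) @ 0 --> v.
    rewrite -[X in _ --> X](addr0 v) -(scale0r x).
    by apply: cvgD; [exact: cvg_cst|exact: scalel_continuous].
  move=> /(_ _ nU) /nbhs_ballP[e /= e0 eb].
  have [w0 [p Up wp]] : punctured_cone U (v + (e / 2) *: x).
    by apply: eb; rewrite /ball /= sub0r normrN gtr0_norm ?divr_gt0//; lra.
  have : domain_cone (v + (e / 2) *: x).
    have : gauge domain_cone y x < m + e / 2 / tau by rewrite ltrDl !divr_gt0.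
    move=> /(gaugeP C_cone _ Cy Cx) /(C_scale _ _ tau0).
    congr domain_cone; rewrite vm; apply/rowP => ?; rewrite !mxE; field.
    by rewrite gt_eqF.
  move=> [_ [_ [q Oq wq]]]; exists p; split; last exact: UB.
  by rewrite (line_unique w0 wp wq).
rewrite (_ : Omega^° = Omega); last exact/interior_id.
move=> Oa; have := domain_cone_coord Oa.
rewrite (chart_coord_eq va v1) vm => /(C_scale tau^-1).
rewrite scalerA mulVf ?gt_eqF// scale1r invr_gt0 => /(_ tau0).
by move=> /(gaugeP C_cone _ Cy Cx); rewrite ltxx.
Qed.

Lemma strictly_betweenP (u v w : 'rV[R]_d) :
  strictly_between u v w <-> exists2 tau, 0 < tau & u = v - tau *: (w - v).
Proof.
split=> [[t /andP[t0 t1] vE]|[tau tau0 uE]].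
  exists (t / (1 - t)); first by rewrite divr_gt0// subr_gt0.
  by rewrite vE; apply/rowP => ?; rewrite !mxE; field; lra.
exists (tau / (1 + tau)).
  have h : 0 < 1 + tau by lra.
  by rewrite divr_gt0//= ltr_pdivrMr//; lra.
by rewrite uE; apply/rowP => ?; rewrite !mxE; field; lra.
Qed.

Lemma strictly_betweenC (u v w : 'rV[R]_d) :
  strictly_between u v w -> strictly_between w v u.
Proof.
move=> [t t01 ->]; exists (1 - t); first lra.
by row_ring.
Qed.

(** The two lengths are [1 + tau] and [tau] times that of [q - p], and [1 + tau^-1] is the gauge by
    [frontier_gauge]. *)
Lemma frontier_ratio (p q a : projective R d) : Omega p -> Omega q ->
  p <> q -> frontier Omega a ->
  strictly_between (coord a) (coord p) (coord q) ->
  `|coord a - coord q| / `|coord a - coord p| =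
  gauge domain_cone (coord q) (coord p).
Proof.
move=> Op Oq pq fa /strictly_betweenP[tau tau0 aE].
have [Cp Cq] := (domain_cone_coord Op, domain_cone_coord Oq).
rewrite (frontier_gauge Cp Cq tau0 fa aE) aE.
have pq0 : `|coord q - coord p| != 0.
  rewrite normr_eq0 subr_eq0; apply/eqP => /esym/chart_coord_inj.
  by move=> /(_ (Om_chart Op) (Om_chart Oq)).
have -> : coord p - tau *: (coord q - coord p) - coord q =
  (1 + tau) *: - (coord q - coord p) by row_ring.
have -> : coord p - tau *: (coord q - coord p) - coord p =
  tau *: - (coord q - coord p) by row_ring.
rewrite !normrZ normrN !gtr0_norm//; last by rewrite addr_gt0.
by field; rewrite pq0 gt_eqF.
Qed.

(** Each half of the cross-ratio is a gauge, whichever frontier points are chosen, so the value is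
    unique; [frontier_exists] supplies both points. *)
Lemma hilbert_valueE (p q : projective R d) (r : R) : Omega p -> Omega q ->
  p <> q -> hilbert_value phi Omega p q r <->
  r = cone_dist domain_cone (coord p) (coord q).
Proof.
move=> Op Oq pq; have qp : q <> p by move=> /esym.
have dstE a b : frontier Omega a -> frontier Omega b ->
    strictly_between (coord a) (coord p) (coord q) ->
    strictly_between (coord p) (coord q) (coord b) ->
    2^-1 * ln ((`|coord a - coord q| * `|coord b - coord p|) /
               (`|coord a - coord p| * `|coord b - coord q|)) =
    cone_dist domain_cone (coord p) (coord q).
  move=> fa fb apq /strictly_betweenC bqp; rewrite -mulf_div.
  rewrite (frontier_ratio Op Oq pq fa apq) (frontier_ratio Oq Op qp fb bqp).
  by rewrite /cone_dist (mulrC (gauge domain_cone (coord q) (coord p))).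
split=> [[a [b [[fa fb] apq pqb ->]]]|->]; first exact: dstE.
have [_ p1] := chart_coordP (Om_chart Op).
have [_ q1] := chart_coordP (Om_chart Oq).
have Cp := domain_cone_coord Op; have Cq := domain_cone_coord Oq.
have pq' : coord p != coord q.
  by apply/eqP => /(chart_coord_inj (Om_chart Op) (Om_chart Oq)).
have qp' : coord q != coord p by rewrite eq_sym.
have [a [s [s0 fa aE]]] := frontier_exists Cp Cq p1 q1 pq'.
have [b [t [t0 fb bE]]] := frontier_exists Cq Cp q1 p1 qp'.
have apq : strictly_between (coord a) (coord p) (coord q).
  by apply/strictly_betweenP; exists s.
have pqb : strictly_between (coord p) (coord q) (coord b).
  by apply/strictly_betweenC/strictly_betweenP; exists t.
by exists a, b; split => //=; rewrite dstE.
Qed.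

End ConvexDomain.

(** * The Hilbert metric as a cone distance *)

Section HilbertGeometry.
Variables (R : realType) (d : nat) (Omega : set (projective R d)).
Hypothesis Om : properly_convex Omega.
Local Notation phi := (hilbert_chart Omega).
Local Notation coord := (chart_coord phi).
Local Notation C := (domain_cone phi Omega).

Let Om_in : properly_convex_in phi Omega.
Proof.
case: Om => psi psiP.
by apply: (@xgetPex _ 0 [set psi | properly_convex_in psi Omega]); exists psi.
Qed.

Let C_cone : open_convex_cone C. Proof. exact: domain_cone_convex Om_in. Qed.

Let C_coord p : Omega p -> C (coord p). Proof. exact: domain_cone_coord. Qed.

Let Om_chart : Omega `<=` affine_chart phi.
Proof. by case: Om_in => _ _ []. Qed.

(** For distinct points [xget] chooses from a singleton, by [hilbert_valueE]. *)
Lemma hilbert_distE (p q : projective R d) : Omega p -> Omega q ->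
  hilbert_dist Omega p q = cone_dist C (coord p) (coord q).
Proof.
move=> Op Oq; rewrite /hilbert_dist; case: eqP => [->|pq].
  by rewrite (cone_dist_refl C_cone)//; exact: C_coord.
apply/(hilbert_valueE Om_in _ Op Oq pq).
apply: (@xgetPex _ 0 (hilbert_value phi Omega p q)).
exists (cone_dist C (coord p) (coord q)).
exact/(hilbert_valueE Om_in _ Op Oq pq).
Qed.

Lemma hilbert_dist_metric : metric_on Omega (hilbert_dist Omega).
Proof.
split=> [p Op|p q Op Oq|p q Op Oq|p q r Op Oq Or].
- rewrite (hilbert_distE Op Op).
  exact: (cone_dist_refl C_cone (C_coord Op)).
- rewrite (hilbert_distE Op Oq).
  exact: (cone_dist_ge0 C_cone (C_coord Op) (C_coord Oq)).
- rewrite (hilbert_distE Op Oq) (hilbert_distE Oq Op).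
  exact: cone_distC.
- rewrite (hilbert_distE Op Or) (hilbert_distE Op Oq) (hilbert_distE Oq Or).
  exact: (cone_dist_trans C_cone (C_coord Op) (C_coord Oq) (C_coord Or)).
Qed.

Definition projective_segment (p q : projective R d) : set (projective R d) :=
  [set r | Omega r /\ exists a b : R,
    [/\ 0 <= a, 0 <= b & a + b = 1] /\ coord r = a *: coord p + b *: coord q].

Lemma hilbert_geodesic_segments :
  geodesic_segments Omega (hilbert_dist Omega) projective_segment.
Proof.
split.
- move=> p q Op Oq; split; split => //.
    by exists 1, 0; rewrite addr0 scale1r scale0r addr0.
  by exists 0, 1; rewrite add0r scale1r scale0r add0r.
- move=> p q r Op Oq [Or [a [b [[a0 b0 ab] rE]]]]; split => //.
  rewrite (hilbert_distE Op Or) (hilbert_distE Or Oq) (hilbert_distE Op Oq) rE.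
  have ab0 : 0 < a + b by rewrite ab ltr01.
  exact: (cone_dist_comb C_cone a0 b0 ab0 (C_coord Op) (C_coord Oq)).
- move=> p q r s Op Oq [Or [a [b [[a0 b0 ab] rE]]]].
  move=> [Os [e [f [[e0 f0 ef] sE]]]].
  split => //; exists (e * a), (e * b + f); split; last first.
    by rewrite sE rE; row_ring.
  split; rewrite ?addr_ge0 ?mulr_ge0//.
  by rewrite addrA -mulrDr ab mulr1.
- move=> p q t Op Oq; rewrite (hilbert_distE Op Oq) => tpq.
  have [a [b [a0 b0 ab tE]]] :=
    cone_dist_point C_cone (C_coord Op) (C_coord Oq) tpq.
  have [r Or rE] := coord_convex Om_in Op Oq a0 b0 ab.
  exists r; first by split => //; exists a, b.
  by rewrite (hilbert_distE Op Or) rE.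
Qed.

Lemma hilbert_quadrilateral :
  quadrilateral_property Omega (hilbert_dist Omega) projective_segment.
Proof.
move=> r p x q y x' y' w c [Op Ox Oq Oy] Oc.
move=> [Ox' [a1 [b1 [ab1 x'E]]]] [Oy' [a2 [b2 [ab2 y'E]]]].
move=> [Ow [a3 [b3 [ab3 wE]]]].
rewrite (hilbert_distE Ow Oc) (hilbert_distE Op Oc) (hilbert_distE Oq Oc).
rewrite (hilbert_distE Ox' Oc) (hilbert_distE Oy' Oc) => wr hx hy.
have hx' : coord x' = coord x \/
  cone_dist C (coord p) (coord c) + r + 2 <= cone_dist C (coord x') (coord c).
  by case: hx => [->|]; [left|right].
have hy' : coord y' = coord y \/
  cone_dist C (coord q) (coord c) + r + 2 <= cone_dist C (coord y') (coord c).
  by case: hy => [->|]; [left|right].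
have [a [b [a0 b0 ab zc]]] := cone_quadrilateral C_cone
  (C_coord Op) (C_coord Ox)
  (C_coord Oq) (C_coord Oy) (C_coord Oc) ab1 x'E ab2 y'E ab3 wE wr hx' hy'.
have [z Oz zE] := coord_convex Om_in Ox Oy a0 b0 ab.
have ab0 : 0 < a + b by rewrite ab ltr01.
exists z; split; first exact: Oz.
  rewrite (hilbert_distE Ox Oz) (hilbert_distE Oz Oy) (hilbert_distE Ox Oy) zE.
  exact: (cone_dist_comb C_cone a0 b0 ab0 (C_coord Ox) (C_coord Oy)).
by rewrite (hilbert_distE Oz Oc) zE.
Qed.

End HilbertGeometry.

Theorem theorem1p17 (R : realType) (d : nat) (Omega : set (projective R d))
    (c : set (projective R d)) :
  properly_convex Omega ->
  geodesic Omega (hilbert_dist Omega) c ->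
  morse Omega (hilbert_dist Omega) c <->
  contracting Omega (hilbert_dist Omega) c.
Proof.
move=> Om cgeo; have met := hilbert_dist_metric Om; split.
  exact: (morse_contracting met (hilbert_geodesic_segments Om)
    (hilbert_quadrilateral Om) cgeo).
exact: (contracting_morse met cgeo).
Qed.
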